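(* Let $u$ be a smooth axisymmetric finite-energy Navier–Stokes solution on $\mathbb R^3\times[0,T)$ with viscosity $\nu>0$, $E_{\rm kin}=\frac12\|u(0)\|_{L^2(\mathbb R^3)}^2$, and circulation $\Gamma=ru^\theta$ satisfying $\|\Gamma(t)\|_{L^\infty}\le\Gamma_*$, $0<\Gamma_*<\infty$. Fix a point $x_*=(0,0,z_* )$ on the symmetry axis. For every $R>0$ and every interval $I\subset[0,T)$, $$\int_I\left[e^{S_R(t)/(2\pi\Gamma_*^2)}-1\right]dt\le\frac{E_{\rm kin}R}{2\pi\nu\Gamma_*^2}.$$ In particular, let $\tau>0$, $I_R=[t_R-\tau R^2,t_R]\subset[0,T)$ and $\langle f\rangle_{I_R}=\frac1{\tau R^2}\int_{I_R}f(t)\,dt$. Then $$\langle S_R\rangle_{I_R}\le2\pi\Gamma_*^2\log\!\left(1+\frac{E_{\rm kin}}{2\pi\nu\Gamma_*^2\tau R}\right).$$ Consequently, for any fixed $R_0>0$ and $C>0$, with $L_R=\log(R_0/R)$, if $$\langle A_R^2\rangle_{I_R}\ge C\,\Gamma_*^2L_R$$ (as $R\downarrow0$, with $\tau$ fixed), then $$\frac{\langle M_R\rangle_{I_R}}{\langle A_R^2\rangle_{I_R}}\ge1-\frac{2\pi}{C}-o(1)\qquad(R\downarrow0).$$ Thus the parabolic-time averaged meridional fraction $\langle M_R\rangle_{I_R}/\langle A_R^2\rangle_{I_R}$ is eventually larger than $1/4$ whenever $C>\frac{8\pi}{3}$.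
   Context: $u=u^re_r+u^\theta e_\theta+u^ze_z$ in cylindrical coordinates, $u^{\rm mer}=u^re_r+u^ze_z$. With $B_R=B_R(x_* )$, $$A_R(t)^2=\frac1R\int_{B_R}|u|^2dx,\quad M_R(t)=\frac1R\int_{B_R}|u^{\rm mer}|^2dx,\quad S_R(t)=A_R(t)^2-M_R(t)=\frac1R\int_{B_R}|u^\theta|^2dx .$$ The solution satisfies the global energy inequality $\nu\int_0^T\int_{\mathbb R^3}|\nabla u|^2\,dx\,dt\le E_{\rm kin}$. *)

(* Defs.v *)
From HB Require Import structures.
From mathcomp Require Import all_boot all_order all_algebra.
From mathcomp Require Import all_classical all_reals all_analysis.

Set Implicit Arguments.
Unset Strict Implicit.
Unset Printing Implicit Defensive.

Import Order.TTheory GRing.Theory Num.Theory.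
Import numFieldNormedType.Exports.

Local Open Scope classical_set_scope.
Local Open Scope ring_scope.

(* Points and vectors of the physical space are row vectors in 'rV[R]_3.      *)
(* The library norm on this type is the sup norm; it is only used for its     *)
(* topology, all Euclidean quantities being written out in coordinates.       *)

Section smoothness.
Context {R : realType} {V W : normedModType R}.

Fixpoint class_C (n : nat) (U : set V) (f : V -> W) : Prop :=
  match n with
  | 0%N => forall p, U p -> {for p, continuous f}
  | n'.+1 => (forall p, U p -> differentiable f p) /\
             (forall v, class_C n' U ('D_v f))
  end.

(* Smoothness on an arbitrary set A: near each point of A, f agrees on A with *)
(* a C^infinity function defined on an open neighborhood of that point. For   *)
(* A = [0, T[ x R^3 this is smoothness up to the initial time.                *)
Definition smooth_on (A : set V) (f : V -> W) : Prop :=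
  forall p, A p -> exists U : set V, exists g : V -> W,
    [/\ open U, U p, (forall q, U q -> A q -> g q = f q) &
        forall n, class_C n U g].

End smoothness.

Section vectors.
Context {R : realType}.
Implicit Types (x v w : 'rV[R]_3).

Definition vec3 (a b c : R) : 'rV[R]_3 := \row_(i < 3) [:: a; b; c]`_i.

Definition dotv v w : R := \sum_(i < 3) v 0 i * w 0 i.

Definition sqnorm v : R := dotv v v.

Definition basis (j : 'I_3) : 'rV[R]_3 := delta_mx 0 j.

Definition rotz (phi : R) x : 'rV[R]_3 :=
  vec3 (cos phi * x 0 0 - sin phi * x 0 1)
       (sin phi * x 0 0 + cos phi * x 0 1)
       (x 0 2).

(* On the axis (radius = 0) division by zero makes e_r and e_theta vanish;    *)
(* the axis is a Lebesgue null set and the circulation is 0 there.            *)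
Definition radius x : R := Num.sqrt (x 0 0 ^+ 2 + x 0 1 ^+ 2).
Definition e_r x : 'rV[R]_3 := vec3 (x 0 0 / radius x) (x 0 1 / radius x) 0.
Definition e_theta x : 'rV[R]_3 :=
  vec3 (- x 0 1 / radius x) (x 0 0 / radius x) 0.
Definition e_z : 'rV[R]_3 := vec3 0 0 1.

Definition axis_point (z : R) : 'rV[R]_3 := vec3 0 0 z.

Definition eball (c : 'rV[R]_3) (rho : R) : set 'rV[R]_3 :=
  [set x | sqnorm (x - c) < rho ^+ 2].

End vectors.

Section integration.
Context {R : realType}.

Definition leb1 : {measure set (measurableTypeR R) -> \bar R} :=
  @lebesgue_measure R.

Definition leb3 := ((@lebesgue_measure R \x @lebesgue_measure R)
                     \x @lebesgue_measure R)%E.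

(* Lebesgue measure on R^3 lives on the triple product R * R * R; functions   *)
(* and sets of 'rV[R]_3 are transported along this coordinate bijection.      *)
Definition of_triple (p : R * R * R) : 'rV[R]_3 := vec3 p.1.1 p.1.2 p.2.

Definition eint3 (f : 'rV[R]_3 -> \bar R) : \bar R :=
  (\int[leb3]_p f (of_triple p))%E.

Definition int3 (D : set 'rV[R]_3) (f : 'rV[R]_3 -> R) : R :=
  \int[leb3]_(p in (of_triple @^-1` D)) f (of_triple p).

Definition Linfty3 (f : 'rV[R]_3 -> R) : \bar R :=
  'N[leb3]_+oo%E[EFin \o f \o of_triple]%E.

(* [0, T[, where T may be +oo *)
Definition lifespan (T : \bar R) : set R := [set t | 0 <= t /\ (t%:E < T)%E].

End integration.

Section navier_stokes.
Context {R : realType}.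
Implicit Types (T : \bar R) (u : R -> 'rV[R]_3 -> 'rV[R]_3)
  (p : R -> 'rV[R]_3 -> R) (t nu : R) (x : 'rV[R]_3).

Definition spacetime T : set (R * 'rV[R]_3) :=
  [set q | lifespan T q.1].

Definition time_derivative u t x : 'rV[R]_3 := 'D_(1 : R) (u ^~ x) t.

Definition advection u t x : 'rV[R]_3 :=
  \sum_(j < 3) u t x 0 j *: 'D_(basis j) (u t) x.

Definition laplacian u t x : 'rV[R]_3 :=
  \sum_(j < 3) 'D_(basis j) ('D_(basis j) (u t)) x.

Definition pressure_gradient p t x : 'rV[R]_3 :=
  \row_(j < 3) 'D_(basis j) (p t) x.

Definition divergence u t x : R :=
  \sum_(j < 3) ('D_(basis j) (u t) x) 0 j.

Definition grad_sq u t x : R :=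
  \sum_(j < 3) sqnorm ('D_(basis j) (u t) x).

(* The momentum equation is imposed at interior times, where the two-sided    *)
(* time derivative is meaningful.                                             *)
Definition smooth_NS_solution nu T u : Prop :=
  smooth_on (spacetime T) (fun q => u q.1 q.2) /\
  exists p : R -> 'rV[R]_3 -> R,
    [/\ smooth_on (spacetime T) (fun q => p q.1 q.2),
        (forall t x, lifespan T t -> divergence u t x = 0) &
        forall t x, 0 < t -> lifespan T t ->
          time_derivative u t x + advection u t x =
          nu *: laplacian u t x - pressure_gradient p t x].

Definition axisymmetric T u : Prop :=
  forall t phi x, lifespan T t -> u t (rotz phi x) = rotz phi (u t x).

Definition E_kin u : R := 2^-1 * int3 setT (fun x => sqnorm (u 0 x)).

Definition global_energy_inequality nu T u : Prop :=
  (nu%:E * \int[leb1]_(t in lifespan T) eint3 (fun x => (grad_sq u t x)%:E)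
     <= (E_kin u)%:E)%E.

Definition finite_energy nu T u : Prop :=
  (exists K : R, forall t, lifespan T t ->
     (eint3 (fun x => (sqnorm (u t x))%:E) <= K%:E)%E) /\
  global_energy_inequality nu T u.

Definition u_r u t x : R := dotv (u t x) (e_r x).
Definition u_theta u t x : R := dotv (u t x) (e_theta x).
Definition u_z u t x : R := dotv (u t x) e_z.

Definition u_mer u t x : 'rV[R]_3 := u_r u t x *: e_r x + u_z u t x *: e_z.

Definition circulation u t x : R := radius x * u_theta u t x.

Definition A_sq u (c : 'rV[R]_3) (rho t : R) : R :=
  rho^-1 * int3 (eball c rho) (fun x => sqnorm (u t x)).

Definition M_mer u (c : 'rV[R]_3) (rho t : R) : R :=
  rho^-1 * int3 (eball c rho) (fun x => sqnorm (u_mer u t x)).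

Definition S_swirl u (c : 'rV[R]_3) (rho t : R) : R :=
  A_sq u c rho t - M_mer u c rho t.

Definition par_interval (tau t rho : R) : set R :=
  [set s | t - tau * rho ^+ 2 <= s <= t].

Definition par_average (tau t rho : R) (f : R -> R) : R :=
  (tau * rho ^+ 2)^-1 * \int[leb1]_(s in par_interval tau t rho) f s.

End navier_stokes.

(* Main.v *)
Require Import Defs.
From HB Require Import structures.
From mathcomp Require Import all_boot all_order all_algebra.
From mathcomp Require Import all_classical all_reals all_analysis.
From mathcomp Require Import measurable_realfun ess_sup_inf.
From mathcomp Require Import ring lra.

Set Implicit Arguments.
Unset Strict Implicit.
Unset Printing Implicit Defensive.

Import Order.TTheory GRing.Theory Num.Theory.
Import numFieldNormedType.Exports.

Local Open Scope classical_set_scope.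
Local Open Scope ring_scope.

(* Write h = |u^theta|^2 and s = r^2. Axisymmetry gives h <= s |grad u|^2, since
   the rotational derivative of u is the rotated velocity, while the circulation
   bound gives h <= Gs^2 / s. Hence, for every a > 0,
     h <= a |grad u|^2 + [s >= a] Gs^2 (1/s - a/s^2),
   the dual form of a bathtub problem. Integrating over the cylinder
   {s <= R^2, |z - z_*| < R}, which contains the ball, and choosing
   a = R^2 / (1 + q) with q = R ||grad u||^2 / (2 pi Gs^2) yields exactly
   S_R <= 2 pi Gs^2 ln (1 + q), that is, the integrand of the first claim is at
   most q; the energy inequality then integrates it in time. The second claim is
   Jensen's inequality, and the third compares ln (1 + c / R) with ln (R_0 / R). *)

(** * Measurability of continuous functions on products *)

(** At a fixed time the swirl bound is a maximisation over densities [h] with [h <= Gs^2 / s] and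
    the integral of [h / s] at most the dissipation. Solving it directly would call for angular
    averages and a rearrangement. A pointwise inequality with a free multiplier [a] replaces both,
    and [a] is fixed only after the space integration, separately at each time, because its best
    value depends on the dissipation at that time. The majorant depends on [s = r^2] alone. The disk
    of squared radius [s] has area [pi * s], so the map [r^2] carries planar Lebesgue measure to
    [pi] times Lebesgue measure on the half-line, and the cylinder integral becomes one-dimensional.
    The other obstacle is measurability. Integrating slices in time requires joint measurability on
    [[0, T[ x R^3], where smoothness is only relative to a set that is not open, and the
    sigma-algebra is the product one. Hence continuity within a set, turned into measurability by a
    countable base of boxes. *)

Section countable_base.
Context d (T : measurableType d) (nb : T -> set_system T).

(** Second countability by measurable sets, relative to an arbitrary neighbourhood system [nb]: this
    form passes to products, with boxes as the base, and so places the open sets of a product in the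
    product sigma-algebra. *)
Definition measurable_countable_base :=
  exists (I : countType) (b : I -> set T), (forall i, measurable (b i)) /\
    forall x U, nb x U -> exists i, b i x /\ b i `<=` U.

Lemma measurable_nbhs_open U : measurable_countable_base ->
  (forall x, U x -> nb x U) -> measurable U.
Proof.
move=> [I [b [mb bP]]] oU.
have -> : U = \bigcup_i (if `[< b i `<=` U >] then b i else set0).
  rewrite predeqE => x; split => [Ux|[i _]].
    have [i [bix bU]] := bP _ _ (oU _ Ux).
    by exists i => //; case: asboolP.
  by case: asboolP => // /[apply].
apply: countable_bigcupT_measurable => [|i]; first exact: countableP.
by case: asboolP.
Qed.

(** [A] need not be open, so the preimage of an interval is written as [A] intersected with the set
    [B] of points having a neighbourhood whose trace on [A] is sent into the interval. [B] is open
    in the whole space, hence a countable union of base sets. *)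
Lemma nbhs_within_measurable_fun (R : realType) (A : set T) (f : T -> R) :
  (forall x, Filter (nb x)) -> (forall x U, nb x U -> U x) ->
  (forall x U, nb x U -> nb x (fun y => nb y U)) ->
  measurable_countable_base -> measurable A ->
  (forall x, A x -> f y @[y --> within A (nb x)] --> f x) -> measurable_fun A f.
Proof.
move=> nbF nbx nbI bT mA cf; apply: (measurability _ (RGenOpens.measurableE R)).
move=> _ [_ [a [b ->]] <-].
set B := [set x | nb x [set y | A y -> f y \in `]a, b[]].
have -> : A `&` f @^-1` `]a, b[ = A `&` B.
  rewrite predeqE => x; split => -[Ax /= fx]; split => //.
    have : within A (nb x) (f @^-1` `]a, b[).
      by apply: cf => //; exact: near_in_itvoo.
    exact.
  by have /= := nbx _ _ fx; exact.
apply: measurableI => //; apply: measurable_nbhs_open => // x Bx.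
exact: nbI.
Qed.

End countable_base.

Lemma measurable_countable_baseR (R : realType) :
  @measurable_countable_base _ (measurableTypeR R) (fun x : R => nbhs x).
Proof.
exists (rat * rat)%type, (fun i => `]ratr i.1, ratr i.2[%classic); split=> [i|x U].
  exact: measurable_itv.
move=> /nbhs_ballP[e /= e0 xU].
have [|p] := @rat_in_itvoo R (x - e) x; first by lra.
have [|q] := @rat_in_itvoo R x (x + e); first by lra.
rewrite !in_itv /= => /andP[q1 q2] /andP[p1 p2]; exists (p, q); split => [|y /=].
  by rewrite /= in_itv /= p2 q1.
by rewrite in_itv /= => /andP[? ?]; apply: xU; rewrite /ball /= ltr_norml; lra.
Qed.

Lemma measurable_countable_base_prod d1 d2 (T1 : measurableType d1)
    (T2 : measurableType d2) (nb1 : T1 -> set_system T1) (nb2 : T2 -> set_system T2) :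
  measurable_countable_base nb1 -> measurable_countable_base nb2 ->
  @measurable_countable_base _ (T1 * T2)%type
    (fun x => filter_prod (nb1 x.1) (nb2 x.2)).
Proof.
move=> [I [b [mb bP]]] [J [c [mc cP]]].
exists (I * J)%type, (fun i => b i.1 `*` c i.2); split=> [i|[x y] U /=].
  exact: measurableX.
move=> [[U1 U2] /= [/bP[i [bi iU]] /cP[j [cj jU]] UU]].
by exists (i, j); split => //= -[p q] [/= /iU ? /jU ?]; exact: UU.
Qed.

Lemma within_continuous_measurable_fun_R4 (R : realType)
    (A : set (measurableTypeR R * (measurableTypeR R * measurableTypeR R * measurableTypeR R)))
    (f : R * (R * R * R) -> R) :
  measurable A ->
  (forall x : R * (R * R * R), A x -> f y @[y --> within A (nbhs x)] --> f x) ->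
  measurable_fun A f.
Proof.
move=> mA cf.
apply: (@nbhs_within_measurable_fun _ _ (fun x : R * (R * R * R) => nbhs x)) => //.
- by move=> x U; exact: nbhs_singleton.
- by move=> x U; exact: nbhs_interior.
apply: measurable_countable_base_prod; first exact: measurable_countable_baseR.
apply: measurable_countable_base_prod; last exact: measurable_countable_baseR.
by apply: measurable_countable_base_prod; exact: measurable_countable_baseR.
Qed.

(** * Radial integrals *)

Section disk.
Context {R : realType}.

Definition leb2 := (@lebesgue_measure R \x @lebesgue_measure R)%E.

Lemma integral_half_circle (r : R) : 0 < r ->
  (\int[lebesgue_measure]_(x in `[(- r)%R, r]) (Num.sqrt (r ^+ 2 - x ^+ 2)%R)%:E)%E
  = (pi / 2 * r ^+ 2)%:E.
Proof.
move=> r0; have pi0 := pi_gt0 R.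
(* Substituting [r * sin x] on [[-pi/2, pi/2]], where the cosine is nonnegative, turns the integrand
   into [r ^+ 2 * cos x ^+ 2]. *)
pose F (x : R) := r * sin x.
have dF (x : R) : is_derive x 1 F (r * cos x).
  exact: (is_derive_eq (is_deriveZ r (is_derive_sin x))).
have F'E : F^`()%classic = (fun x => r * cos x).
  by apply/funext => x; rewrite derive1E; exact: (derive_val (is_derive := dF x)).
have cF' : continuous F^`()%classic.
  by rewrite F'E => x; apply: cvgM; [exact: cvg_cst|exact: continuous_cos].
have cF : continuous F.
  by move=> x; apply: cvgM; [exact: cvg_cst|exact: continuous_sin].
have := @integration_by_substitution_increasing R F
  (fun x => Num.sqrt (r ^+ 2 - x ^+ 2)) (- (pi / 2)) (pi / 2).
have -> : F (pi / 2) = r by rewrite /F sin_pihalf mulr1.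
have -> : F (- (pi / 2)) = - r by rewrite /F sinN sin_pihalf mulrN mulr1.
move=> ->; first last.
- apply: continuous_subspaceT => x; apply: continuous_comp.
    by apply: cvgB; [exact: cvg_cst|exact: exprn_continuous].
  exact: sqrt_continuous.
- split=> [x _||]; first by case: (dF x).
    by apply: cvg_at_right_filter; exact: cF.
  by apply: cvg_at_left_filter; exact: cF.
- by apply/cvg_ex; exists (F^`()%classic (pi / 2)); apply: cvg_at_left_filter; exact: cF'.
- by apply/cvg_ex; exists (F^`()%classic (- (pi / 2))); apply: cvg_at_right_filter; exact: cF'.
- by move=> x _; exact: cF'.
- by move=> x y xI yI xy; rewrite /F ltr_pM2l// ltr_sin.
- by lra.
pose K (x : R) := r ^+ 2 / 2 * (x + sin x * cos x).
have dK (x : R) : is_derive x 1 K (r ^+ 2 * cos x ^+ 2).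
  apply: (is_derive_eq (is_deriveZ (r ^+ 2 / 2) (is_deriveD (is_derive_id x 1)
    (is_deriveM (is_derive_sin x) (is_derive_cos x))))); rewrite /GRing.scale/=.
  by rewrite -[cos x * cos x]expr2 cos2sin2; field.
have cK : continuous K.
  move=> x; apply: differentiable_continuous; apply/derivable1_diffP.
  by case: (dK x).
transitivity (\int[lebesgue_measure]_(x in `[(- (pi / 2))%R, (pi / 2)%R])
    (r ^+ 2 * cos x ^+ 2)%:E)%E.
  apply: eq_integral => x; rewrite inE /= in_itv /= => xI; rewrite /= F'E !fctE; congr EFin.
  have -> : r ^+ 2 - F x ^+ 2 = (r * cos x) ^+ 2.
    by rewrite /F !exprMn cos2sin2 mulrBr mulr1.
  rewrite sqrtr_sqr ger0_norm; first by ring.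
  by apply: mulr_ge0; [exact: ltW|exact: cos_ge0_pihalf].
rewrite (@continuous_FTC2 _ (fun x => r ^+ 2 * cos x ^+ 2) K); first last.
- by move=> x _; rewrite derive1E; exact: (derive_val (is_derive := dK x)).
- split=> [x _||]; first by case: (dK x).
    by apply: cvg_at_right_filter; exact: cK.
  by apply: cvg_at_left_filter; exact: cK.
- apply: continuous_subspaceT => x; apply: cvgM; first exact: cvg_cst.
  by apply: (@continuous_comp _ _ _ cos (fun y => y ^+ 2)); 
    [exact: continuous_cos|exact: exprn_continuous].
- by lra.
by rewrite -EFinB /K cosN cos_pihalf; congr EFin; field.
Qed.

(** The sign of [c] is free: [Num.sqrt] is [0] on negative numbers, so both sides are then false.
    Sections of a disk are thus intervals, possibly empty, by a single formula. *)
Lemma sqr_lt_sqrt (y c : R) : (y ^+ 2 < c) = (- Num.sqrt c < y < Num.sqrt c).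
Proof.
rewrite -ltr_norml; have [c0|c0] := lerP c 0.
  rewrite ler0_sqrtr// [RHS]ltNge normr_ge0 ltNge.
  by rewrite (le_trans c0 (sqr_ge0 _)).
by rewrite -[in LHS](sqr_sqrtr (ltW c0)) -(real_normK (num_real y)) ltr_pXn2r// nnegrE.
Qed.

Lemma measurable_radius2 :
  measurable_fun [set: measurableTypeR R * measurableTypeR R]
    (fun p => p.1 ^+ 2 + p.2 ^+ 2 : measurableTypeR R).
Proof.
apply: (@measurable_funD _ (measurableTypeR R * measurableTypeR R)%type R _
  (fun p => p.1 ^+ 2) (fun p => p.2 ^+ 2)); apply: measurable_funX.
- exact: measurable_fst.
- exact: measurable_snd.
Qed.

Lemma disk_area (s : R) : 0 < s ->
  leb2 [set p | p.1 ^+ 2 + p.2 ^+ 2 < s] = (pi * s)%:E.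
Proof.
move=> s0; rewrite /leb2 /product_measure1 /=.
have -> : (fun x => lebesgue_measure (xsection [set p : R * R | p.1 ^+ 2 + p.2 ^+ 2 < s] x))
  = (fun x => (2 * Num.sqrt (s - x ^+ 2))%:E).
  apply/funext => x.
  have -> : xsection [set p : R * R | p.1 ^+ 2 + p.2 ^+ 2 < s] x =
      `] - Num.sqrt (s - x ^+ 2), Num.sqrt (s - x ^+ 2) [%classic.
    rewrite predeqE => y; rewrite /xsection /= inE /= in_itv /= -sqr_lt_sqrt; split=> h; lra.
  rewrite lebesgue_measure_itv /= lte_fin -EFinB.
  case: ltP => [_|]; first by congr EFin; ring.
  by have := sqrtr_ge0 (s - x ^+ 2) => ? ?; congr EFin; lra.
pose r := Num.sqrt s.
have r0 : 0 < r by rewrite sqrtr_gt0.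
have rs : r ^+ 2 = s by rewrite sqr_sqrtr// ltW.
have mf (D : set R) : measurable D -> measurable_fun D (fun x : R => (Num.sqrt (s - x ^+ 2))%:E).
  move=> mD; apply: measurable_funTS; apply/measurable_EFinP.
  apply: continuous_measurable_fun => x; apply: continuous_comp.
    by apply: cvgB; [exact: cvg_cst|exact: exprn_continuous].
  exact: sqrt_continuous.
under eq_integral do rewrite EFinM.
rewrite ge0_integralZl //; last exact: mf.
rewrite -(setUv `[- r, r]%classic) ge0_integral_setU//=; first last.
- by apply/disj_setPS; rewrite setICr.
- by rewrite setUv; exact: mf.
- exact: measurableC.
rewrite [X in (_ + X)%E]integral0_eq ?adde0; last first.
  move=> x /= /negP; rewrite in_itv /= => xr; rewrite ler0_sqrtr//.
  rewrite -rs subr_le0 -(real_normK (num_real x)) ler_pXn2r ?nnegrE// ?ltW//.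
  by move: xr; rewrite -ler_norml -ltNge.
by rewrite -rs integral_half_circle// -EFinM; congr EFin; field.
Qed.

End disk.

Section radial.
Context {R : realType}.
Let mu := @lebesgue_measure R.
Let rad2 (p : measurableTypeR R * measurableTypeR R) : measurableTypeR R := p.1 ^+ 2 + p.2 ^+ 2.

Let pi_nng : {nonneg R} := NngNum (pi_ge0 R).

(** Polar coordinates in the variable [r^2]. Since [disk_area] is linear in [s], the two measures
    agree on the rays []-oo, x[], which form a generating pi-system. The restriction to the positive
    half-line is there because Lebesgue measure also charges negative numbers. *)
Lemma radius2_pushforward (A : set (measurableTypeR R)) : measurable A -> A `<=` `]0, +oo[ ->
  pushforward leb2 rad2 A = mscale pi_nng mu A.
Proof.
move=> mA A0.
have mD : measurable (`]0, +oo[%classic : set (measurableTypeR R)).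
  exact: measurable_itv.
pose m1 : measure (measurableTypeR R) R :=
  measure_function_pushforward__canonical__measure_function_Measure leb2
    (@measurable_radius2 R).
pose m2 : measure (measurableTypeR R) R := mscale pi_nng (mrestr mu mD).
have m2E B : m2 B = (pi%:E * mu (B `&` `]0%R, +oo[))%E by [].
have mx (x : R) : m1 `]-oo, x[%classic = (pi * Num.max x 0)%:E.
  have -> : m1 `]-oo, x[%classic = leb2 [set p | p.1 ^+ 2 + p.2 ^+ 2 < x] by [].
  have [x0|x0] := lerP x 0.
    have -> : [set p : R * R | p.1 ^+ 2 + p.2 ^+ 2 < x] = set0.
      rewrite predeqE => p; split => //=.
      have := sqr_ge0 p.1; have := sqr_ge0 p.2; lra.
    by rewrite mulr0; exact: measure0.
  exact: disk_area.
transitivity (m2 A).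
  change (m1 A = m2 A).
  apply: (@measure_unique _ _ _ (@RGenInftyO.G R : set (set (measurableTypeR R)))
    (fun n => `]-oo, n%:R[%classic) _ _ _ _ m1 m2) => //.
  - exact: RGenInftyO.measurableE.
  - move=> _ _ [x ->] [y ->]; exists (Num.min x y).
    by rewrite predeqE => z; rewrite /= !in_itv /= lt_min; split=> [[-> ->]|/andP].
  - by move=> n; exists n%:R.
  - rewrite predeqE => x; split => // _; exists (Num.bound `|x|) => //=.
    rewrite in_itv /=; have := archi_boundP (normr_ge0 x).
    exact: le_lt_trans (ler_norm x).
  - move=> _ [x ->]; rewrite mx m2E.
    have -> : `]-oo, x[ `&` `]0, +oo[ = `]0, x[%classic :> set R.
      by rewrite predeqE => z; rewrite /= !in_itv /= andbT; split=> [[-> ->]|/andP[]].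
    rewrite /mu lebesgue_measure_itv /= lte_fin EFinM.
    by case: ltP => _; rewrite ?mule0// oppr0 adde0.
  - by move=> n; rewrite mx ltry.
by rewrite m2E; congr (_ * mu _)%E; exact/setIidPl.
Qed.

Lemma integral_radial (D : set (measurableTypeR R)) (f : R -> \bar R) : measurable D ->
  D `<=` `]0, +oo[ -> measurable_fun D f -> (forall s, D s -> (0 <= f s)%E) ->
  (\int[leb2]_(p in [set p : R * R | D (rad2 p)]) f (rad2 p)
   = pi%:E * \int[mu]_(s in D) f s)%E.
Proof.
move=> mD D0 mf f0.
transitivity (\int[mscale pi_nng mu]_(s in D) f s)%E; last first.
  by rewrite ge0_integral_mscale.
have f0' : {in D, forall s, (0 <= f s)%E} by move=> x; rewrite inE; exact: f0.
rewrite -(@ge0_integral_pushforward _ _ _ _ _ rad2 (@measurable_radius2 R) leb2 D f mD mf f0').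
apply: eq_measure_integral; first exact: measurable_radius2.
move=> ? A mA AD.
exact: (radius2_pushforward mA (subset_trans AD D0)).
Qed.

End radial.

(** * Tonelli and cylinder integrals in three dimensions *)

Section product_sigma_finite.
Context d1 d2 (T1 : measurableType d1) (T2 : measurableType d2) (R : realType).
Context (m1 : {sigma_finite_measure set T1 -> \bar R}).
Context (m2 : {sigma_finite_measure set T2 -> \bar R}).

Lemma sigma_finite_product_measure : sigma_finite setT (m1 \x m2)%E.
Proof.
have /sigma_finiteP[F [TF ndF Foo]] := sigma_finiteT m1.
have /sigma_finiteP[G [TG ndG Goo]] := sigma_finiteT m2.
exists (fun n => F n `*` G n) => [|n]; last first.
  have [[mF Fn] [mG Gn]] := (Foo n, Goo n).
  split; first exact: measurableX.
  by rewrite product_measure1E// lte_mul_pinfty// ge0_fin_numE.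
apply/seteqP; split => // -[x y] _.
have [i _ Fx] : (\bigcup_i F i) x by rewrite -TF.
have [j _ Gy] : (\bigcup_i G i) y by rewrite -TG.
exists (maxn i j) => //; split.
- by move: Fx; apply/subsetPset/ndF/leq_maxl.
- by move: Gy; apply/subsetPset/ndG/leq_maxr.
Qed.

(* The canonical sigma-finite structure on [m1 \x m2] is keyed on pairs of
   subprobabilities, so that it is not inferred for Lebesgue measure. *)
Definition sigma_finite_product :
    {sigma_finite_measure set (T1 * T2)%type -> \bar R} :=
  HB.pack_for {sigma_finite_measure set (T1 * T2)%type -> \bar R}
    (m1 \x m2)%E
    (Measure_isSigmaFinite.Build _ _ _ (m1 \x m2)%E sigma_finite_product_measure).

End product_sigma_finite.

Section leb3.
Context {R : realType}.
Let mR := measurableTypeR R.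

Definition sigma_finite_leb2 := sigma_finite_product (@lebesgue_measure R) (@lebesgue_measure R).
Definition sigma_finite_leb3 := sigma_finite_product sigma_finite_leb2 (@lebesgue_measure R).

Lemma tonelli_leb3 (h : mR * mR * mR -> \bar R) :
  measurable_fun setT h -> (forall p, (0 <= h p)%E) ->
  (\int[leb3]_p h p = \int[leb2]_p \int[lebesgue_measure]_z h (p, z))%E.
Proof.
move=> mh h0.
exact: (@fubini_tonelli1 _ _ _ _ _ sigma_finite_leb2 _ h mh h0).
Qed.

End leb3.

Lemma integral_invr_sub_invr2 (R : realType) (a b : R) : 0 < a <= b ->
  (\int[lebesgue_measure]_(s in `[a, b]) (s^-1 - a / s ^+ 2)%:E
   = (ln (b / a) + a / b - 1)%:E)%E.
Proof.
(* The degenerate interval does occur: zero dissipation makes the multiplier [a] equal to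
   [rho ^+ 2]. *)
move=> /andP[a0]; rewrite le_eqVlt => /predU1P[<-|ab].
  rewrite set_itv1 integral_set1 divff ?gt_eqF// ln1; congr EFin.
  by rewrite add0r subrr.
pose F (s : R) := ln s + a * s^-1.
have dF (s : R) : 0 < s -> is_derive s 1 F (s^-1 - a / s ^+ 2).
  move=> s0; have sN0 : s != 0 by rewrite gt_eqF.
  apply: (is_derive_eq (is_deriveD (is_derive1_ln s0)
    (is_deriveZ a (is_deriveV sN0 (is_derive_id s 1))))).
  by rewrite /GRing.scale/=; field.
have cF (s : R) : 0 < s -> {for s, continuous F}.
  move=> s0; apply: differentiable_continuous; apply/derivable1_diffP.
  by case: (dF s s0).
have b0 := lt_trans a0 ab.
rewrite (@continuous_FTC2 _ _ F)//.
- rewrite -EFinB /F ln_div ?posrE//; congr EFin; field.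
  by rewrite !gt_eqF.
- apply: continuous_in_subspaceT => s; rewrite inE /= in_itv /= => /andP[as_ _].
  have sN0 : s != 0 by rewrite gt_eqF// (lt_le_trans a0).
  apply: cvgB; first exact: inv_continuous.
  apply: cvgM; first exact: cvg_cst.
  apply: cvgV; [by rewrite expf_neq0|exact: exprn_continuous].
- split=> [s||].
  + rewrite in_itv /= => /andP[as_ _].
    by case: (dF s (lt_trans a0 as_)).
  + by apply: cvg_at_right_filter; exact: cF.
  + by apply: cvg_at_left_filter; exact: cF.
- move=> s; rewrite in_itv /= => /andP[as_ _].
  by rewrite derive1E; exact: (derive_val (is_derive := dF s (lt_trans a0 as_))).
Qed.

Section cylinder.
Context {R : realType}.
Let mR := measurableTypeR R.
Let rad2 (p : mR * mR) : mR := p.1 ^+ 2 + p.2 ^+ 2.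

Definition cylinder_shell (D : set R) (z rho : R) : set (R * R * R) :=
  [set p | D (p.1.1 ^+ 2 + p.1.2 ^+ 2) /\ z - rho < p.2 < z + rho].

Lemma measurable_cylinder_shell (D : set mR) (z rho : R) : measurable D ->
  measurable (cylinder_shell D z rho : set (mR * mR * mR)).
Proof.
move=> mD; have -> : cylinder_shell D z rho =
    (rad2 @^-1` D) `*` `]z - rho, z + rho[%classic.
  by rewrite predeqE => p; rewrite /cylinder_shell /= in_itv.
apply: measurableX; last exact: measurable_itv.
by rewrite -[X in measurable X]setTI; exact: measurable_radius2.
Qed.

Lemma integral_cylinder (D : set mR) (f : R -> \bar R) (z rho : R) : 0 < rho ->
  measurable D -> D `<=` `]0, +oo[ -> measurable_fun D f ->
  (forall s, D s -> (0 <= f s)%E) ->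
  (\int[leb3]_(p in cylinder_shell D z rho) f (p.1.1 ^+ 2 + p.1.2 ^+ 2)%R
   = (pi * (2 * rho))%R%:E * \int[lebesgue_measure]_(s in D) f s)%E.
Proof.
move=> rho0 mD D0 mf f0.
set J : set mR := `]z - rho, z + rho[%classic.
have mJ : measurable J by exact: measurable_itv.
have leb_J : @lebesgue_measure R J = (2 * rho)%:E.
  rewrite lebesgue_measure_itv /= lte_fin ifT; last by lra.
  by rewrite -EFinB; congr EFin; ring.
have mrad := @measurable_radius2 R.
pose g (p : mR * mR) := ((f \_ D) (rad2 p))%E.
have fD0 s : (0 <= (f \_ D) s)%E.
  by apply: erestrict_ge0 => x; exact: f0.
have g0 p : (0 <= g p)%E by exact: fD0.
have mg : measurable_fun setT g.
  apply: (@measurableT_comp _ _ _ _ _ _ (f \_ D) _ rad2) => //.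
  exact/(measurable_restrictT _ _).1.
rewrite integral_mkcond.
transitivity (\int[leb3]_p (g p.1 * (\1_J p.2)%:E))%E.
  apply: eq_integral => -[[x y] t] _; rewrite /g !patchE /= indicE.
  have -> : ((x, y, t) \in cylinder_shell D z rho) = (x ^+ 2 + y ^+ 2 \in D) && (t \in J).
    apply/idP/andP => [/set_mem[Dxy tJ]|[/set_mem Dxy /set_mem]].
      by split; rewrite inE//= /J /= in_itv.
    by rewrite /J /= in_itv /= inE.
  rewrite /rad2 /=; case: (_ \in D); case: (_ \in J) => /=; rewrite ?mule1 ?mule0 ?mul0e//.
pose h (p : mR * mR * mR) := (g p.1 * (\1_J p.2)%:E)%E.
have h0 p : (0 <= h p)%E by rewrite mule_ge0// lee_fin.
have mh : measurable_fun setT h.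
  apply: emeasurable_funM.
    by apply: measurableT_comp => //; exact: measurable_fst.
  apply/measurable_EFinP.
  apply: (@measurableT_comp _ _ _ _ _ _ (\1_J : mR -> R) _ snd).
    exact: measurable_indic.
  exact: measurable_snd.
rewrite (tonelli_leb3 mh h0).
transitivity (\int[leb2]_p ((2 * rho)%:E * g p))%E.
  apply: eq_integral => p _; rewrite /h /=.
  rewrite ge0_integralZl//.
    by rewrite integral_indic// setIT muleC; congr (_ * _)%E; exact: leb_J.
  by apply/measurable_EFinP; exact: measurable_indic.
rewrite ge0_integralZl//; last by rewrite lee_fin; lra.
rewrite [X in (_ * X)%E](_ : _ = \int[leb2]_(p in [set p : mR * mR | D (rad2 p)]) f (rad2 p))%E.
  by rewrite integral_radial// muleA -EFinM mulrC.
rewrite [RHS]integral_mkcond; apply: eq_integral => p _.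
by rewrite /g !patchE; congr (if _ then _ else _); apply/idP/idP; rewrite !inE.
Qed.

End cylinder.

(** * Consequences of axisymmetry *)

Lemma derive_comp_curve (R : realType) (V W : normedModType R) (c : R -> V)
    (f : V -> W) (t : R) : derivable c t 1 -> differentiable f (c t) ->
  'D_1 (f \o c) t = 'd f (c t) ('D_1 c t).
Proof.
move=> /derivable1_diffP dc df.
by rewrite (deriveE (1 : R) (differentiable_comp dc df)) (deriveE (1 : R) dc) diff_comp.
Qed.

Section vectors.
Context {R : realType}.
Implicit Types x y v w : 'rV[R]_3.

Lemma vec3E (a b c : R) :
  ((vec3 a b c 0 0 = a) * (vec3 a b c 0 1 = b) * (vec3 a b c 0 2 = c))%type.
Proof. by rewrite /vec3 !mxE. Qed.

Lemma vec3P x y : x 0 0 = y 0 0 -> x 0 1 = y 0 1 -> x 0 2 = y 0 2 -> x = y.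
Proof.
move=> h0 h1 h2; apply/rowP => i.
case/or3P : (ltac:(by case: i => -[|[|[|]]]) : [|| i == 0, i == 1 | i == 2]) => /eqP -> //.
Qed.

Lemma dotvE v w : dotv v w = v 0 0 * w 0 0 + v 0 1 * w 0 1 + v 0 2 * w 0 2.
Proof.
rewrite /dotv !big_ord_recl big_ord0 addr0 addrA.
by congr (_ * _ + _ * _ + _ * _); congr (_ 0 _); apply/val_inj.
Qed.

Lemma sqnormE v : sqnorm v = v 0 0 ^+ 2 + v 0 1 ^+ 2 + v 0 2 ^+ 2.
Proof. by rewrite /sqnorm dotvE !expr2. Qed.

(** The infinitesimal generator of the rotations about the axis, that is [r e_theta]. It is applied
    both to points and to velocities. *)
Definition rot_field x := vec3 (- x 0 1) (x 0 0) 0.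

Lemma rotz0 x : rotz 0 x = x.
Proof. by apply: vec3P; rewrite /rotz !vec3E ?cos0 ?sin0; ring. Qed.

Lemma rot_fieldE x : rot_field x = - x 0 1 *: Defs.basis 0 + x 0 0 *: Defs.basis 1.
Proof. by apply: vec3P; rewrite !vec3E !mxE /=; ring. Qed.

Lemma is_derive_scalel (f : R -> R) (w : 'rV[R]_3) (t df : R) :
  is_derive t 1 f df -> is_derive t 1 (fun s => f s *: w) (df *: w).
Proof.
move=> [dft fE]; have dfd : differentiable f t by exact/derivable1_diffP.
have dfw := differentiableZl w dfd.
split; first exact/derivable1_diffP.
by rewrite (deriveE (1 : R) dfw) (diffZl w dfd) -(deriveE (1 : R) dfd) fE.
Qed.

Lemma is_derive_rotz x : is_derive (0 : R) (1 : R) (rotz ^~ x) (rot_field x).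
Proof.
pose a := vec3 (x 0 0) (x 0 1) 0; pose b := rot_field x; pose c := vec3 0 0 (x 0 2).
have -> : rotz ^~ x = (fun phi => cos phi *: a) + (fun phi => sin phi *: b) + cst c.
  by apply/funext => phi; apply: vec3P; rewrite /rotz !mxE /=; ring.
have dc := is_derive_scalel a (is_derive_cos (0 : R)).
have ds := is_derive_scalel b (is_derive_sin (0 : R)).
apply: (is_derive_eq (is_deriveD (is_deriveD dc ds) (is_derive_cst c (0 : R) (1 : R)))).
by rewrite sin0 cos0 oppr0 scale0r scale1r add0r addr0.
Qed.

End vectors.

Section smooth_field.
Context {R : realType}.
Context (T : \bar R) (u : R -> 'rV[R]_3 -> 'rV[R]_3).
Hypothesis su : smooth_on (spacetime T) (fun q => u q.1 q.2).

(** [spacetime T] is not open at time [0], so joint differentiability and continuity are read off a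
    local extension [g]. Spatial derivatives of [u] then become derivatives of [g] along
    [(0, v)]. *)
Lemma smooth_extension t x : lifespan T t ->
  exists U (g : R * 'rV[R]_3 -> 'rV[R]_3), [/\ open U, U (t, x),
    (forall s y, U (s, y) -> lifespan T s -> g (s, y) = u s y),
    (forall p, U p -> differentiable g p) &
    (forall v p, U p -> {for p, continuous ('D_v g)})].
Proof.
move=> Tt; have [U [g [oU Ux gu Cg]]] := su (p := (t, x)) Tt.
have [dg cg] := Cg 1%N.
exists U, g; split => // s y Usy Ts; exact: (gu (s, y)).
Qed.

Lemma derive_pair (g : R * 'rV[R]_3 -> 'rV[R]_3) s y v :
  'D_v (fun z => g (s, z)) y = 'D_((0, v) : R * 'rV[R]_3) g (s, y).
Proof.
rewrite /derive; set F := (fun h => _); set G := (fun h => _).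
suff -> : F = G by [].
apply/funext => h; rewrite /F /G /=; congr (_ *: (g _ - _)).
by congr (_, _); rewrite /= scaler0 add0r.
Qed.

Lemma derive_slice (U : set (R * 'rV[R]_3)) g s y v : open U -> U (s, y) ->
  (forall s y, U (s, y) -> lifespan T s -> g (s, y) = u s y) -> lifespan T s ->
  'D_v (u s) y = 'D_((0, v) : R * 'rV[R]_3) g (s, y).
Proof.
move=> oU Usy gu Ts.
have nU : \forall z \near y, u s z = g (s, z).
  have [[A B] [/= As By] AB] : nbhs (s, y) U by exact: open_nbhs_nbhs.
  apply: filterS By => z Bz; apply/esym/gu => //.
  by apply: AB; split => //=; exact: nbhs_singleton As.
by rewrite (near_eq_derive v nU) derive_pair.
Qed.

Lemma differentiable_slice (g : R * 'rV[R]_3 -> 'rV[R]_3) s y :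
  differentiable g (s, y) -> differentiable (fun z => g (s, z)) y.
Proof.
move=> dg; exact: (@differentiable_comp _ _ _ _ (fun z => (s, z)) g).
Qed.

Hypothesis au : axisymmetric T u.

(* obtained by differentiating [u (rotz phi x) = rotz phi (u x)] at [phi = 0] *)
Lemma derive_rot_field t (x : 'rV[R]_3) : lifespan T t ->
  - x 0 1 *: 'D_(Defs.basis 0) (u t) x + x 0 0 *: 'D_(Defs.basis 1) (u t) x
  = rot_field (u t x).
Proof.
move=> Tt; have [U [g [oU Ux gu dg _]]] := smooth_extension x Tt.
rewrite !(derive_slice _ oU Ux gu Tt).
pose f z := g (t, z).
have df : differentiable f x by apply: differentiable_slice; exact: dg.
have fE v : 'D_((0, v) : R * 'rV[R]_3) g (t, x) = 'd f x v.
  by rewrite -(deriveE v df) derive_pair.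
rewrite !fE -!linearZ -linearD -rot_fieldE.
have [dr' dr1] := is_derive_rotz x.
have [_ dru1] := is_derive_rotz (u t x).
have dr : differentiable (rotz ^~ x) 0 by exact/derivable1_diffP.
rewrite -dr1 -dru1.
have df0 : differentiable f (rotz 0 x) by rewrite rotz0.
have := derive_comp_curve dr' df0; rewrite rotz0 => <-.
(* The chain rule was applied to the extension, which agrees with [u t] only near [x]; for small
   [phi] the rotated point stays in that neighbourhood. *)
apply: near_eq_derive.
have [[A B] [/= At Bx] AB] : nbhs (t, x) U by exact: open_nbhs_nbhs.
have : \forall phi \near (0 : R), B (rotz phi x).
  have := differentiable_continuous dr; apply; by rewrite rotz0.
apply: filterS => phi Bphi; rewrite /f /= gu ?au//.
by apply: AB; split => //=; exact: nbhs_singleton At.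
Qed.

End smooth_field.

(** * Joint measurability in time and space *)

Section joint_measurability.
Context {R : realType}.
Let mR := measurableTypeR R.

Lemma measurable_section_leb3 (L : set mR) (f : mR * (mR * mR * mR) -> \bar R) (t : R) :
  measurable L -> L t -> measurable_fun (L `*` setT) f ->
  measurable_fun setT (fun p => f (t, p)).
Proof.
move=> mL Lt mf.
have mLT : measurable (L `*` setT : set (mR * (mR * mR * mR))) by exact: measurableX.
have mg := (measurable_restrictT f mLT).1 mf.
have := measurableT_comp mg (measurable_pair1 t).
by apply: eq_measurable_fun => p _; rewrite /= patchE mem_set.
Qed.

Lemma measurable_time_integral (L : set mR) (D : set (mR * mR * mR))
    (f : mR * (mR * mR * mR) -> \bar R) :
  measurable L -> measurable D -> measurable_fun (L `*` setT) f ->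
  (forall q, (L `*` D) q -> (0 <= f q)%E) ->
  measurable_fun L (fun t => \int[leb3]_(p in D) f (t, p))%E.
Proof.
move=> mL mD mf f0.
have mLD : measurable (L `*` D : set (mR * (mR * mR * mR))) by exact: measurableX.
have sLD : L `*` D `<=` L `*` setT by move=> x [].
have mfD : measurable_fun (L `*` D) f.
  by apply: measurable_funS mf => //; exact: measurableX.
have mg := (measurable_restrictT f mLD).1 mfD.
have g0 q : (0 <= (f \_ (L `*` D)) q)%E by exact: erestrict_ge0.
have := @measurable_fun_fubini_tonelli_F _ _ _ _ _ (sigma_finite_leb3 (R := R)) _ mg g0.
move=> /(measurable_funS measurableT (@subsetT _ L)).
apply: eq_measurable_fun => t /set_mem Lt.
rewrite /fubini_F [RHS]integral_mkcond; apply: eq_integral => p _.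
rewrite !patchE; congr (if _ then _ else _).
by apply/idP/idP; rewrite !inE => // -[].
Qed.

Lemma measurable_invr : measurable_fun [set: mR] (fun x : mR => x^-1 : mR).
Proof.
have m0 : measurable ([set 0] : set mR) by exact: (measurable_set1 (0 : R)).
have mN0 := measurableC m0.
(* The inverse takes the default value [0] at [0] and is discontinuous there, so this point is split
   off. *)
rewrite -(setUv [set 0]); apply/(measurable_funU _ m0 mN0).
split; first exact: measurable_fun_set1.
apply: open_continuous_measurable_fun.
  by apply: closed_openC; exact: closed_eq.
by move=> x; rewrite inE => /eqP x0; exact: inv_continuous.
Qed.

End joint_measurability.

Lemma measurable_lifespan (R : realType) (T : \bar R) :
  measurable (lifespan T : set (measurableTypeR R)).
Proof.
case: T => [r| |].
- rewrite (_ : lifespan _ = `[0, r[%classic); first exact: measurable_itv.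
  by apply/seteqP; split => t; rewrite /lifespan /= in_itv /= lte_fin => /andP.
- rewrite (_ : lifespan _ = `[0, +oo[%classic); first exact: measurable_itv.
  by apply/seteqP; split => t; rewrite /lifespan /= in_itv /= ltry andbT => // -[].
- rewrite (_ : lifespan _ = set0); first exact: measurable0.
  by apply/seteqP; split => t // -[]; rewrite ltNge leNye.
Qed.

Section smooth_field_measurability.
Context {R : realType}.
Context (T : \bar R) (u : R -> 'rV[R]_3 -> 'rV[R]_3).
Hypothesis su : smooth_on (spacetime T) (fun q => u q.1 q.2).
Let mR := measurableTypeR R.

Lemma velocity_within_continuous t (x : 'rV[R]_3) : lifespan T t ->
  u q.1 q.2 @[q --> within (spacetime T) (nbhs (t, x))] --> u t x.
Proof.
move=> Tt; have [U [g [oU Ux gu dg _]]] := smooth_extension su x Tt.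
have gc : g q @[q --> within (spacetime T) (nbhs (t, x))] --> g (t, x).
  by apply: cvg_within_filter; exact: differentiable_continuous (dg _ Ux).
rewrite -(gu _ _ Ux Tt); apply: cvg_trans gc; apply: near_eq_cvg.
have : nbhs (t, x) U by exact: open_nbhs_nbhs.
by apply: filterS => -[s y] Usy Ts; exact: gu.
Qed.

Lemma gradient_within_continuous v t (x : 'rV[R]_3) : lifespan T t ->
  'D_v (u q.1) q.2 @[q --> within (spacetime T) (nbhs (t, x))] --> 'D_v (u t) x.
Proof.
move=> Tt; have [U [g [oU Ux gu _ cg]]] := smooth_extension su x Tt.
pose G := 'D_((0, v) : R * 'rV[R]_3) g.
have gc : G q @[q --> within (spacetime T) (nbhs (t, x))] --> G (t, x).
  by apply: cvg_within_filter; exact: cg.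
rewrite (derive_slice v oU Ux gu Tt); apply: cvg_trans gc; apply: near_eq_cvg.
have : nbhs (t, x) U by exact: open_nbhs_nbhs.
by apply: filterS => -[s y] Usy Ts; rewrite (derive_slice v oU Usy gu Ts).
Qed.

Lemma of_triple_continuous : continuous (@of_triple R).
Proof.
have -> : @of_triple R = (fun p => p.1.1 *: vec3 1 0 0) + (fun p => p.1.2 *: vec3 0 1 0)
    + (fun p => p.2 *: vec3 0 0 1).
  by apply/funext => p; apply: vec3P; rewrite /of_triple !mxE /=; ring.
move=> p; apply: cvgD; first apply: cvgD.
- by apply: cvgZr_tmp; apply: (@cvg_comp _ _ _ fst fst); exact: cvg_fst.
- by apply: cvgZr_tmp; apply: (@cvg_comp _ _ _ fst snd); [exact: cvg_fst|exact: cvg_snd].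
- by apply: cvgZr_tmp; exact: cvg_snd.
Qed.

Lemma measurable_spacetime_field (F : R -> 'rV[R]_3 -> 'rV[R]_3) i :
  (forall t (x : 'rV[R]_3), lifespan T t ->
    F q.1 q.2 @[q --> within (spacetime T) (nbhs (t, x))] --> F t x) ->
  measurable_fun (lifespan T `*` setT : set (mR * (mR * mR * mR)))
    (fun q => F q.1 (of_triple q.2) 0 i).
Proof.
move=> cF.
apply: within_continuous_measurable_fun_R4.
  by apply: measurableX => //; exact: measurable_lifespan.
move=> [t p] [/= Tt _].
pose e (q : R * (R * R * R)) : R * 'rV[R]_3 := (q.1, of_triple q.2).
have ce : e q @[q --> within (lifespan T `*` setT) (nbhs (t, p))]
    --> within (spacetime T) (nbhs (t, of_triple p)).
  move=> A; rewrite /within /= => nA.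
  have [[B1 B2] [/= B1t B2p] sB] := nA.
  exists (B1, of_triple @^-1` B2).
    by split => //=; exact: of_triple_continuous B2p.
  by move=> [s q] [/= B1s B2q] [/= Ts _]; exact: (sB (s, of_triple q)).
have h := @cvg_comp _ _ _ e (fun q => F q.1 q.2) _ _ _ ce (cF t (of_triple p) Tt).
apply: (@cvg_comp _ _ _ _ (fun v : 'rV[R]_3 => v 0 i) _ _ _ h).
exact: coord_continuous.
Qed.

End smooth_field_measurability.

(** * The exponential swirl bound *)

Section swirl_pointwise.
Context {R : realType}.
Context (T : \bar R) (u : R -> 'rV[R]_3 -> 'rV[R]_3).
Hypothesis su : smooth_on (spacetime T) (fun q => u q.1 q.2).
Hypothesis au : axisymmetric T u.
Implicit Types x : 'rV[R]_3.

Lemma sqr_radius x : Defs.radius x ^+ 2 = x 0 0 ^+ 2 + x 0 1 ^+ 2.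
Proof. by rewrite /Defs.radius sqr_sqrtr// addr_ge0// sqr_ge0. Qed.

Lemma radius_eq0 x : Defs.radius x = 0 -> x 0 0 = 0 /\ x 0 1 = 0.
Proof.
move=> r0; have := sqr_radius x; rewrite r0 expr0n /= => /esym/eqP.
by rewrite paddr_eq0 ?sqr_ge0// !sqrf_eq0 => /andP[/eqP -> /eqP ->].
Qed.

Lemma u_thetaE t x :
  u_theta u t x = (x 0 0 * u t x 0 1 - x 0 1 * u t x 0 0) / Defs.radius x.
Proof. by rewrite /u_theta dotvE /e_theta !vec3E; ring. Qed.

Lemma sqr_circulation t x : circulation u t x ^+ 2
  = (x 0 0 ^+ 2 + x 0 1 ^+ 2) * u_theta u t x ^+ 2.
Proof. by rewrite /circulation exprMn sqr_radius. Qed.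

(** On the axis the generator of rotations vanishes, so [derive_rot_field] forces
    [rot_field (u t x) = 0]. This makes the splitting into meridional and swirl parts exact even
    where [e_r] and [e_theta] are [0] by default. *)
Lemma axis_velocity t x : lifespan T t -> Defs.radius x = 0 ->
  u t x 0 0 = 0 /\ u t x 0 1 = 0.
Proof.
move=> Tt /radius_eq0[x0 x1]; have := derive_rot_field su au x Tt.
move: ('D_(Defs.basis 0) _ _) ('D_(Defs.basis 1) _ _) => d0 d1.
rewrite x0 x1 oppr0 !scale0r addr0 => h.
have := congr1 (fun v : 'rV[R]_3 => v 0 0) h; have := congr1 (fun v : 'rV[R]_3 => v 0 1) h.
rewrite /rot_field !vec3E !mxE => <- /esym/eqP; rewrite oppr_eq0 => /eqP ->.
by [].
Qed.

Lemma sqnorm_mer_swirl t x : lifespan T t ->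
  sqnorm (u_mer u t x) = sqnorm (u t x) - u_theta u t x ^+ 2.
Proof.
move=> Tt; rewrite !sqnormE u_thetaE /u_mer /u_r /u_z !dotvE /e_r /e_z !mxE /=.
have [r0|rN0] := eqVneq (Defs.radius x) 0.
  have [-> ->] := axis_velocity Tt r0.
  by rewrite r0 invr0; ring.
have x0E : x 0 0 ^+ 2 = Defs.radius x ^+ 2 - x 0 1 ^+ 2 by rewrite sqr_radius; ring.
set r := Defs.radius x in rN0 x0E *; set a := u t x 0 0; set b := u t x 0 1.
move: x0E; set p := x 0 0; set q := x 0 1 => pE.
apply/eqP; rewrite -subr_eq0; apply/eqP.
(* The difference of the two sides is a multiple of [p ^+ 2 + q ^+ 2 - r ^+ 2], which isolates the
   only place where [r] has to be the radius. *)
transitivity (((a * p + b * q) ^+ 2 * (p ^+ 2 + q ^+ 2 - r ^+ 2)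
   + r ^+ 2 * (a ^+ 2 + b ^+ 2) * (p ^+ 2 + q ^+ 2 - r ^+ 2)) / r ^+ 4).
  by field.
by rewrite pE subrK subrr !mulr0 addr0 mul0r.
Qed.

Lemma sum_sqnorm_ge (D : 'I_3 -> 'rV[R]_3) :
  sqnorm (D 0) + sqnorm (D 1) <= \sum_(j < 3) sqnorm (D j).
Proof.
rewrite !big_ord_recl big_ord0 addr0 addrA.
have -> : lift ord0 ord0 = 1 :> 'I_3 by exact/val_inj.
by rewrite lerDl sqnormE !addr_ge0// sqr_ge0.
Qed.

Lemma sqr_u_theta_le_grad_sq t x : lifespan T t ->
  u_theta u t x ^+ 2 <= (x 0 0 ^+ 2 + x 0 1 ^+ 2) * grad_sq u t x.
Proof.
move=> Tt; have := sum_sqnorm_ge (fun j => 'D_(Defs.basis j) (u t) x).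
have := derive_rot_field su au x Tt.
rewrite -/(grad_sq u t x).
move: ('D_(Defs.basis 0) _ _) ('D_(Defs.basis 1) _ _) (grad_sq u t x) => d0 d1 g h gE.
have h0 : - u t x 0 1 = - x 0 1 * d0 0 0 + x 0 0 * d1 0 0.
  by have := congr1 (fun v : 'rV[R]_3 => v 0 0) h; rewrite /rot_field !vec3E !mxE.
have h1 : u t x 0 0 = - x 0 1 * d0 0 1 + x 0 0 * d1 0 1.
  by have := congr1 (fun v : 'rV[R]_3 => v 0 1) h; rewrite /rot_field !vec3E !mxE.
(* Cauchy-Schwarz through Lagrange's identity: the defect is [(b * c + a * d) ^+ 2]. *)
have cs (a b c d : R) : (- a * c + b * d) ^+ 2 <= (b ^+ 2 + a ^+ 2) * (c ^+ 2 + d ^+ 2).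
  by have := sqr_ge0 (b * c + a * d); nra.
apply: (@le_trans _ _ (u t x 0 0 ^+ 2 + u t x 0 1 ^+ 2)).
  rewrite u_thetaE exprMn exprVn sqr_radius.
  have [->|rN0] := eqVneq (x 0 0 ^+ 2 + x 0 1 ^+ 2) 0.
    by rewrite invr0 mulr0 addr_ge0// sqr_ge0.
  have r0 : 0 < x 0 0 ^+ 2 + x 0 1 ^+ 2 by rewrite lt_neqAle eq_sym rN0 addr_ge0 ?sqr_ge0.
  by rewrite ler_pdivrMr//; have := sqr_ge0 (x 0 0 * u t x 0 0 + x 0 1 * u t x 0 1); nra.
apply: le_trans (ler_wpM2l _ gE); last by rewrite addr_ge0 ?sqr_ge0.
rewrite -[u t x 0 1 ^+ 2]sqrrN h0 h1 !sqnormE.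
apply: le_trans (lerD (cs _ _ _ _) (cs _ _ _ _)) _.
rewrite -mulrDr ler_wpM2l ?addr_ge0 ?sqr_ge0//.
by have := sqr_ge0 (d0 0 2); have := sqr_ge0 (d1 0 2); lra.
Qed.

(* weak duality for the bathtub problem: [a] is the multiplier of the
   dissipation constraint *)
Lemma sqr_u_theta_le_bathtub (a Gs : R) t x : lifespan T t -> 0 < a ->
  `|circulation u t x| <= Gs ->
  u_theta u t x ^+ 2 <= a * grad_sq u t x +
    (if a <= x 0 0 ^+ 2 + x 0 1 ^+ 2 then
      Gs ^+ 2 * ((x 0 0 ^+ 2 + x 0 1 ^+ 2)^-1 - a / (x 0 0 ^+ 2 + x 0 1 ^+ 2) ^+ 2)
     else 0).
Proof.
move=> Tt a0 cG; have := sqr_u_theta_le_grad_sq x Tt.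
have : (x 0 0 ^+ 2 + x 0 1 ^+ 2) * u_theta u t x ^+ 2 <= Gs ^+ 2.
  rewrite -sqr_circulation -(real_normK (num_real _)).
  by rewrite ler_pXn2r ?nnegrE// (le_trans _ cG).
have g0 : 0 <= grad_sq u t x.
  by apply: sumr_ge0 => j _; rewrite sqnormE !addr_ge0 ?sqr_ge0.
move: g0; set g := grad_sq u t x; set h := u_theta u t x ^+ 2.
set s := x 0 0 ^+ 2 + x 0 1 ^+ 2 => g0 sh hg.
have [as_|sa] := lerP a s; last by rewrite addr0 (le_trans hg)// ler_wpM2r// ltW.
have s0 : 0 < s by exact: lt_le_trans as_.
(* A convex combination with weights [a / s] and [1 - a / s]: the first share of [h] is bounded by
   the gradient, the second by the circulation. *)
have -> : h = a / s * h + (s * h) * (s^-1 - a / s ^+ 2) by field; rewrite gt_eqF.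
apply: lerD.
  by rewrite -mulrA ler_pM2l// ler_pdivrMl.
apply: ler_wpM2r => //.
have -> : s^-1 - a / s ^+ 2 = (s - a) / s ^+ 2 by field; rewrite gt_eqF.
by rewrite divr_ge0 ?subr_ge0// exprn_ge0// ltW.
Qed.

End swirl_pointwise.

(** * Measurability of the energy densities *)

Section energy_densities.
Context {R : realType}.
Context (T : \bar R) (u : R -> 'rV[R]_3 -> 'rV[R]_3).
Hypothesis su : smooth_on (spacetime T) (fun q => u q.1 q.2).
Let mR := measurableTypeR R.
Let LT : set (mR * (mR * mR * mR)) := lifespan T `*` setT.

Lemma measurable_sqnorm_field (F : R -> 'rV[R]_3 -> 'rV[R]_3) :
  (forall t (x : 'rV[R]_3), lifespan T t ->
    F q.1 q.2 @[q --> within (spacetime T) (nbhs (t, x))] --> F t x) ->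
  measurable_fun LT (fun q => sqnorm (F q.1 (of_triple q.2))).
Proof.
move=> cF; have m i := measurable_spacetime_field i cF.
under eq_fun do rewrite sqnormE.
by apply: measurable_funD; [apply: measurable_funD|]; apply: measurable_funX.
Qed.

Lemma measurable_sqnorm_velocity :
  measurable_fun LT (fun q => sqnorm (u q.1 (of_triple q.2))).
Proof.
by apply: measurable_sqnorm_field => t x Tt; exact: velocity_within_continuous.
Qed.

Lemma measurable_grad_sq :
  measurable_fun LT (fun q => grad_sq u q.1 (of_triple q.2)).
Proof.
apply: measurable_sum => j.
apply: (measurable_sqnorm_field (F := fun t => 'D_(Defs.basis j) (u t))) => t x Tt.
exact: gradient_within_continuous.
Qed.

Lemma measurable_shell_radius2 (L : set (mR * (mR * mR * mR))) :
  measurable_fun L (fun q => q.2.1.1 ^+ 2 + q.2.1.2 ^+ 2 : mR).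
Proof.
apply: (@measurable_funTS _ _ _ _ _
  (fun q : mR * (mR * mR * mR) => q.2.1.1 ^+ 2 + q.2.1.2 ^+ 2 : mR)).
apply: (@measurableT_comp _ _ _ _ _ _ (fun p : mR * mR => p.1 ^+ 2 + p.2 ^+ 2 : mR)).
  exact: measurable_radius2.
exact: (measurableT_comp measurable_fst measurable_snd).
Qed.

Lemma measurable_sqr_u_theta :
  measurable_fun LT (fun q => u_theta u q.1 (of_triple q.2) ^+ 2).
Proof.
have m i := measurable_spacetime_field i (velocity_within_continuous su).
have -> : (fun q : mR * (mR * mR * mR) => u_theta u q.1 (of_triple q.2) ^+ 2) =
  (fun q => (q.2.1.1 * u q.1 (of_triple q.2) 0 1 - q.2.1.2 * u q.1 (of_triple q.2) 0 0) ^+ 2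
   * (q.2.1.1 ^+ 2 + q.2.1.2 ^+ 2)^-1).
  by apply/funext => q; rewrite u_thetaE exprMn exprVn sqr_radius /of_triple !vec3E.
have c1 : measurable_fun LT (fun q => q.2.1.1).
  apply: measurable_funTS.
  exact: (measurableT_comp measurable_fst (measurableT_comp measurable_fst measurable_snd)).
have c2 : measurable_fun LT (fun q => q.2.1.2).
  apply: measurable_funTS.
  exact: (measurableT_comp measurable_snd (measurableT_comp measurable_fst measurable_snd)).
apply: measurable_funM.
  by apply: measurable_funX; apply: measurable_funB; apply: measurable_funM.
apply: (measurableT_comp (@measurable_invr R)).
exact: measurable_shell_radius2.
Qed.

End energy_densities.

Lemma Linfty3_ae (R : realType) (f : 'rV[R]_3 -> R) (C : R) :
  (Linfty3 f <= C%:E)%E -> {ae leb3, forall p, `|f (of_triple p)| <= C}.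
Proof.
rewrite /Linfty3 unlock; case: ifPn => [_ /ess_supP|].
  by apply: filterS => p; rewrite /= lee_fin.
(* In this branch the whole space has measure zero, so it serves as the exceptional set. *)
rewrite -leNgt => h _; exists setT; split => //.
by apply/eqP; rewrite eq_le h measure_ge0.
Qed.

Lemma measurable_eball (R : realType) (c : 'rV[R]_3) (rho : R) :
  measurable (of_triple @^-1` eball c rho
    : set (measurableTypeR R * measurableTypeR R * measurableTypeR R)).
Proof.
pose mR := measurableTypeR R.
have -> : of_triple @^-1` eball c rho =
    (fun p : mR * mR * mR => (p.1.1 - c 0 0) ^+ 2 + (p.1.2 - c 0 1) ^+ 2 + (p.2 - c 0 2) ^+ 2 : mR)
    @^-1` `]-oo, rho ^+ 2[.
  by apply/seteqP; split => p; rewrite /eball /= in_itv /= sqnormE !mxE.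
rewrite -[X in measurable X]setTI.
have c1 : measurable_fun setT (fun p : mR * mR * mR => p.1.1 : mR).
  exact: (measurableT_comp measurable_fst measurable_fst).
have c2 : measurable_fun setT (fun p : mR * mR * mR => p.1.2 : mR).
  exact: (measurableT_comp measurable_snd measurable_fst).
have c3 : measurable_fun setT (fun p : mR * mR * mR => p.2 : mR).
  exact: measurable_snd.
suff m : measurable_fun setT
    (fun p : mR * mR * mR => (p.1.1 - c 0 0) ^+ 2 + (p.1.2 - c 0 1) ^+ 2 + (p.2 - c 0 2) ^+ 2 : mR).
  by apply: m => //; exact: measurable_itv.
by apply: measurable_funD; [apply: measurable_funD|]; apply: measurable_funX;
  apply: measurable_funB => //; exact: measurable_cst.
Qed.

Section fixed_time.
Context {R : realType}.
Context (T : \bar R) (u : R -> 'rV[R]_3 -> 'rV[R]_3).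
Hypothesis su : smooth_on (spacetime T) (fun q => u q.1 q.2).
Hypothesis au : axisymmetric T u.
Context (Gs zs rho t : R).
Hypotheses (Gs0 : 0 < Gs) (rho0 : 0 < rho) (Tt : lifespan T t).
Hypothesis circ : {ae leb3, forall p, `|circulation u t (of_triple p)| <= Gs}.
Let mR := measurableTypeR R.
Let ball : set (mR * mR * mR) := of_triple @^-1` eball (axis_point zs) rho.
Let rad2 (p : mR * mR * mR) : R := p.1.1 ^+ 2 + p.1.2 ^+ 2.

Let mball : measurable ball. Proof. exact: measurable_eball. Qed.

Lemma measurable_slice_field (f : R * (R * R * R) -> R) :
  measurable_fun (lifespan T `*` setT : set (mR * (mR * mR * mR))) f ->
  measurable_fun setT (fun p : mR * mR * mR => (f (t, p))%:E).
Proof.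
move=> mf; apply: (@measurable_section_leb3 _ (lifespan T) (EFin \o f)) => //.
  exact: measurable_lifespan.
exact/measurable_EFinP.
Qed.

Lemma eball_axis p : ball p -> rad2 p < rho ^+ 2 /\ zs - rho < p.2 < zs + rho.
Proof.
rewrite /ball /eball /= sqnormE !mxE /= !subr0 => h.
have h2 := sqr_ge0 (p.2 - zs); have h1 : 0 <= rad2 p by rewrite addr_ge0 ?sqr_ge0.
have : (p.2 - zs) ^+ 2 < rho ^+ 2 by rewrite /rad2 in h1; lra.
rewrite sqr_lt_sqrt sqrtr_sqr gtr0_norm// /rad2 => ?; lra.
Qed.

(** Both terms of the pointwise bound are nonnegative, so each is integrated over its own larger
    domain: the gradient over all of space, the radial weight over a cylinder of height [2 * rho],
    where its integral is explicit. *)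
Lemma swirl_energy_le (a : R) : 0 < a <= rho ^+ 2 ->
  (\int[leb3]_(p in ball) (u_theta u t (of_triple p) ^+ 2)%:E
   <= a%:E * eint3 (fun x => (grad_sq u t x)%:E)
    + (Gs ^+ 2 * (pi * (2 * rho)) * (ln (rho ^+ 2 / a) + a / rho ^+ 2 - 1))%:E)%E.
Proof.
move=> /andP[a0 arho].
pose D : set mR := `[a, rho ^+ 2]%classic.
have mD : measurable D by exact: measurable_itv.
have D0 : D `<=` `]0, +oo[.
  by move=> s; rewrite /D /= !in_itv /= andbT => /andP[/(lt_le_trans a0)].
pose w (s : R) := Gs ^+ 2 * (s^-1 - a / s ^+ 2).
have w0 s : a <= s -> 0 <= w s.
  move=> as_; have s0 : 0 < s by exact: lt_le_trans as_.
  have -> : w s = Gs ^+ 2 * ((s - a) / s ^+ 2) by rewrite /w; field; rewrite gt_eqF.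
  by rewrite !mulr_ge0 ?invr_ge0 ?subr_ge0 ?exprn_ge0// ltW.
have mw : measurable_fun setT (w : mR -> mR).
  have mi : measurable_fun setT (fun s : mR => s^-1 : mR) := @measurable_invr R.
  apply: measurable_funM; first exact: measurable_cst.
  apply: measurable_funB => //; apply: measurable_funM; first exact: measurable_cst.
  under eq_fun do rewrite -exprVn; exact: measurable_funX.
pose shell : set (mR * mR * mR) := cylinder_shell D zs rho.
have mshell : measurable shell by exact: measurable_cylinder_shell.
pose W p := (w (rad2 p))%:E.
have mW : measurable_fun setT W.
  apply/measurable_EFinP; apply: (measurableT_comp mw).
  exact: (measurableT_comp (@measurable_radius2 R) measurable_fst).
have W0 p : shell p -> (0 <= W p)%E.
  by move=> -[]; rewrite /D /= in_itv /= lee_fin => /andP[/w0].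
(* The weight is negative for [0 < s < a], so it is cut off to the shell [a <= s <= rho ^+ 2]. *)
pose K := (W \_ shell)%E.
have mK : measurable_fun setT K.
  exact: (measurable_restrictT W mshell).1 (measurable_funTS mW).
have K0 p : (0 <= K p)%E by exact: erestrict_ge0.
pose g p := (grad_sq u t (of_triple p))%:E.
have mg : measurable_fun setT g := measurable_slice_field (measurable_grad_sq su).
have g0 p : (0 <= g p)%E.
  by rewrite lee_fin; apply: sumr_ge0 => j _; rewrite sqnormE !addr_ge0 ?sqr_ge0.
have mag : measurable_fun setT (fun p => a%:E * g p)%E by exact: measurable_funeM.
have ag0 p : (0 <= a%:E * g p)%E by rewrite mule_ge0// lee_fin ltW.
apply: (@le_trans _ _ (\int[leb3]_(p in ball) (a%:E * g p + K p))%E).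
  apply: ae_ge0_le_integral => //.
  - by move=> p _; rewrite lee_fin sqr_ge0.
  - by apply: measurable_funTS; exact: measurable_slice_field (measurable_sqr_u_theta su).
  - by move=> p _; exact: adde_ge0.
  - by apply: measurable_funTS; exact: emeasurable_funD.
  have aeF : Filter (almost_everywhere (@leb3 R)).
    exact: (ae_filter_ringOfSetsType (sigma_finite_leb3 (R := R))).
  apply: filterS circ => p cp /eball_axis[sr zr].
  have := sqr_u_theta_le_bathtub su au Tt a0 cp.
  have -> : of_triple p 0 0 ^+ 2 + of_triple p 0 1 ^+ 2 = rad2 p.
    by rewrite /of_triple !vec3E.
  rewrite /g /K patchE /W -EFinM => h.
  case: ifPn h => [as_|as_] h.
    rewrite mem_set ?lee_fin// /shell /cylinder_shell; split => //.
    by rewrite /D /= in_itv /= as_ ltW.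
  rewrite memNset ?adde0 ?lee_fin//; first by rewrite addr0 in h.
  by move=> -[]; rewrite /D /= in_itv /= => /andP[as' _] _; rewrite -/(rad2 p) as' in as_.
rewrite ge0_integralD//; [|exact: measurable_funTS|exact: measurable_funTS].
apply: leeD.
  rewrite -ge0_integralZl//; [|by move=> p _; exact: g0|by rewrite lee_fin ltW].
  exact: ge0_subset_integral.
apply: (@le_trans _ _ (\int[leb3]_p K p)%E).
  exact: ge0_subset_integral.
rewrite /K -integral_mkcond.
rewrite (integral_cylinder zs rho0 (f := fun s => (w s)%:E) mD D0)//; first last.
- by move=> s; rewrite /D /= in_itv /= lee_fin => /andP[/w0].
- by apply: measurable_funTS; exact/measurable_EFinP.
have eD : (\int[lebesgue_measure]_(s in D) (w s)%:E
    = (Gs ^+ 2)%:E * \int[lebesgue_measure]_(s in D) (s^-1 - a / s ^+ 2)%:E)%E.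
  rewrite /w; under eq_integral do rewrite EFinM.
  rewrite ge0_integralZl//.
  - have mw1 : measurable_fun setT (fun s : mR => (Gs ^+ 2)^-1 * w s).
      by apply: measurable_funM => //; exact: measurable_cst.
    apply/measurable_EFinP; apply: measurable_funTS.
    apply: eq_measurable_fun mw1 => s _.
    by rewrite /w mulKf// expf_neq0// gt_eqF.
  - move=> s; rewrite /D /= in_itv /= lee_fin => /andP[/w0 + _].
    by rewrite /w pmulr_rge0// exprn_gt0.
  - by rewrite lee_fin sqr_ge0.
rewrite eD integral_invr_sub_invr2 ?a0//.
by rewrite -!EFinM lee_fin mulrA [_ * Gs ^+ 2]mulrC -!mulrA.
Qed.

End fixed_time.

Section swirl_bound.
Context {R : realType}.
Context (T : \bar R) (u : R -> 'rV[R]_3 -> 'rV[R]_3).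
Hypothesis su : smooth_on (spacetime T) (fun q => u q.1 q.2).
Hypothesis au : axisymmetric T u.
Context (zs rho t K : R).
Hypotheses (rho0 : 0 < rho) (Tt : lifespan T t).
Hypothesis uK : (eint3 (fun x => (sqnorm (u t x))%:E) <= K%:E)%E.
Let mR := measurableTypeR R.
Let ball : set (mR * mR * mR) := of_triple @^-1` eball (axis_point zs) rho.

Let mball : measurable ball. Proof. exact: measurable_eball. Qed.

Lemma sqnorm_ge0 (v : 'rV[R]_3) : 0 <= sqnorm v.
Proof. by rewrite sqnormE !addr_ge0 ?sqr_ge0. Qed.

Lemma sqr_u_theta_le (x : 'rV[R]_3) : u_theta u t x ^+ 2 <= sqnorm (u t x).
Proof.
by rewrite -subr_ge0 -(sqnorm_mer_swirl su au x Tt); exact: sqnorm_ge0.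
Qed.

Lemma ball_energy_le :
  (\int[leb3]_(p in ball) (sqnorm (u t (of_triple p)))%:E <= K%:E)%E.
Proof.
apply: le_trans uK; apply: ge0_subset_integral => //.
  exact: measurable_slice_field (measurable_sqnorm_velocity su).
by move=> p _; rewrite lee_fin sqnorm_ge0.
Qed.

(** Real-valued integrals replace an infinite value by [0], so subtracting the integrals in
    [S_swirl] is legitimate only once the energy bound [K] makes them finite. *)
Lemma ge0_ball_integrable (f : R * R * R -> R) :
  measurable_fun setT (fun p : mR * mR * mR => (f p)%:E) ->
  (forall p, 0 <= f p <= sqnorm (u t (of_triple p))) ->
  (sigma_finite_leb3 (R := R)).-integrable ball (fun p => (f p)%:E).
Proof.
move=> mf f0; apply/integrableP; split; first exact: measurable_funTS.
apply: (@le_lt_trans _ _ K%:E); last exact: ltry.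
apply: le_trans ball_energy_le; apply: ge0_le_integral => //.
- by apply: measurable_funTS; apply: measurableT_comp.
- apply: measurable_funTS.
  exact: measurable_slice_field (measurable_sqnorm_velocity su).
- by move=> p _; rewrite lee_fin; have /andP[? ?] := f0 p; rewrite ger0_norm.
Qed.

Lemma integrable_sqr_u_theta : (sigma_finite_leb3 (R := R)).-integrable ball
  (fun p => (u_theta u t (of_triple p) ^+ 2)%:E).
Proof.
apply: ge0_ball_integrable => [|p].
  exact: measurable_slice_field (measurable_sqr_u_theta su).
by rewrite sqr_ge0 sqr_u_theta_le.
Qed.

Lemma integrable_sqnorm : (sigma_finite_leb3 (R := R)).-integrable ball
  (fun p => (sqnorm (u t (of_triple p)))%:E).
Proof.
apply: ge0_ball_integrable => [|p].
  exact: measurable_slice_field (measurable_sqnorm_velocity su).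
by rewrite sqnorm_ge0 lexx.
Qed.

Lemma S_swirlE : S_swirl u (axis_point zs) rho t
  = rho^-1 * int3 (eball (axis_point zs) rho) (fun x => u_theta u t x ^+ 2).
Proof.
rewrite /S_swirl /A_sq /M_mer -mulrBr; congr (_ * _).
have := @RintegralB _ _ _ (sigma_finite_leb3 (R := R)) ball _ _ mball
  integrable_sqnorm integrable_sqr_u_theta.
rewrite /int3 => h.
have -> : \int[leb3]_(p in ball) sqnorm (u_mer u t (of_triple p))
    = \int[leb3]_(p in ball) (sqnorm (u t (of_triple p)) - u_theta u t (of_triple p) ^+ 2).
  by apply: eq_Rintegral => p _; exact: (sqnorm_mer_swirl su au (of_triple p) Tt).
by rewrite [X in _ - X]h subKr.
Qed.

Lemma S_swirl_ge0 : 0 <= S_swirl u (axis_point zs) rho t.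
Proof.
rewrite S_swirlE mulr_ge0 ?invr_ge0 ?(ltW rho0)//.
by apply: Rintegral_ge0 => p _; exact: sqr_ge0.
Qed.

Lemma A_sq_bound : 0 <= A_sq u (axis_point zs) rho t <= rho^-1 * K.
Proof.
rewrite /A_sq /int3; apply/andP; split.
  rewrite mulr_ge0 ?invr_ge0 ?(ltW rho0)//.
  by apply: Rintegral_ge0 => p _; exact: sqnorm_ge0.
rewrite ler_wpM2l ?invr_ge0 ?(ltW rho0)// /Rintegral.
rewrite -lee_fin fineK; first exact: ball_energy_le.
exact: integrable_fin_num integrable_sqnorm.
Qed.

Lemma S_swirl_le_A_sq : S_swirl u (axis_point zs) rho t <= A_sq u (axis_point zs) rho t.
Proof.
rewrite /S_swirl gerBl /M_mer mulr_ge0 ?invr_ge0 ?(ltW rho0)//.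
by apply: Rintegral_ge0 => p _; exact: sqnorm_ge0.
Qed.

Context (Gs : R).
Hypothesis Gs0 : 0 < Gs.
Hypothesis circ : {ae leb3, forall p, `|circulation u t (of_triple p)| <= Gs}.

Lemma expR_S_swirl_le :
  ((expR (S_swirl u (axis_point zs) rho t / (2 * pi * Gs ^+ 2)) - 1)%:E
   <= (rho / (2 * pi * Gs ^+ 2))%:E * eint3 (fun x => (grad_sq u t x)%:E))%E.
Proof.
have g0 : (0 <= eint3 (fun x => (grad_sq u t x)%:E))%E.
  by apply: integral_ge0 => p _; rewrite lee_fin; apply: sumr_ge0 => j _; exact: sqnorm_ge0.
have pi0 := pi_gt0 R.
have k0 : 0 < 2 * pi * Gs ^+ 2 by rewrite !mulr_gt0// exprn_gt0.
have := swirl_energy_le su au zs Gs0 rho0 Tt circ.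
(* Infinite dissipation at a given time is not excluded; the right-hand side is then infinite. *)
case gE : (eint3 _) g0 => [g| |] // g0; last first.
  by move=> _; rewrite gt0_muley ?leey// lte_fin divr_gt0.
rewrite lee_fin in g0.
rewrite S_swirlE /int3 /Rintegral.
set I := (\int[leb3]_(p in ball) (u_theta u t (of_triple p) ^+ 2)%:E)%E.
have : (fine I)%:E = I := fineK (integrable_fin_num mball integrable_sqr_u_theta).
move: (fine I) => H <-.
set k := 2 * pi * Gs ^+ 2 in k0 *; pose q := rho / k * g.
have q0 : 0 <= q by rewrite /q mulr_ge0// divr_ge0// ltW.
have q1 : 0 < 1 + q by rewrite ltr_wpDr.
(* This [a] minimises the right-hand side of [swirl_energy_le]: its derivative in [a] vanishes when
   [1 / a = 1 / rho ^+ 2 + g / (k * rho)]. *)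
move=> /(_ (rho ^+ 2 / (1 + q))); rewrite divr_gt0 ?exprn_gt0//=.
rewrite ler_pdivrMr// ler_peMr ?exprn_ge0 ?(ltW rho0) ?lerDl// => /(_ isT).
have rN0 : rho != 0 by rewrite gt_eqF.
have qN0 : 1 + q != 0 by rewrite gt_eqF.
have kN0 : k != 0 by rewrite gt_eqF.
have -> : rho ^+ 2 / (rho ^+ 2 / (1 + q)) = 1 + q by field; rewrite qN0.
have gq : g = k * q / rho by rewrite /q; field; rewrite ?kN0 ?rN0.
rewrite -EFinM -EFinD lee_fin => HH.
rewrite -EFinM lee_fin -/q lerBlDl -ler_ln ?posrE ?expR_gt0// expRK.
rewrite ler_pdivrMr// mulrC ler_pdivrMr//.
apply: le_trans HH _; rewrite {1}gq /=.
(* The gradient term [rho * k * q / (1 + q)] cancels against [rho * k * (a / rho ^+ 2 - 1)], leaving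
   only the logarithm. *)
have -> : rho ^+ 2 / (1 + q) * (k * q / rho)
  + Gs ^+ 2 * (pi * (2 * rho)) * (ln (1 + q) + rho ^+ 2 / (1 + q) / rho ^+ 2 - 1)
  = rho * k * (ln (1 + q)) by rewrite /k in kN0 *; field; rewrite ?qN0 ?rN0.
by rewrite le_eqVlt; apply/orP; left; apply/eqP; ring.
Qed.

End swirl_bound.

(** * Integration in time *)

Section swirl_in_time.
Context {R : realType}.
Context (nu : R) (T : \bar R) (u : R -> 'rV[R]_3 -> 'rV[R]_3) (Gs zs : R).
Hypothesis nu0 : 0 < nu.
Hypothesis su : smooth_on (spacetime T) (fun q => u q.1 q.2).
Hypothesis au : axisymmetric T u.
Hypothesis eu : finite_energy nu T u.
Hypothesis Gs0 : 0 < Gs.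
Hypothesis circ : forall t, lifespan T t -> (Linfty3 (circulation u t) <= Gs%:E)%E.
Let mR := measurableTypeR R.
Local Notation xs := (axis_point zs).

Lemma measurable_int3_ball (f : R -> 'rV[R]_3 -> R) rho :
  measurable_fun (lifespan T `*` setT : set (mR * (mR * mR * mR)))
    (fun q => f q.1 (of_triple q.2)) ->
  (forall t x, 0 <= f t x) ->
  measurable_fun (lifespan T) (fun t : mR => int3 (eball xs rho) (f t) : mR).
Proof.
move=> mf f0.
apply: (@measurableT_comp _ _ _ _ _ _ (@fine R)); first exact: fine_measurable.
apply: (@measurable_time_integral _ (lifespan T) _ (fun q => (f q.1 (of_triple q.2))%:E)).
- exact: measurable_lifespan.
- exact: measurable_eball.
- exact/measurable_EFinP.
- by move=> q _; rewrite lee_fin.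
Qed.

Lemma measurable_A_sq rho : measurable_fun (lifespan T) (A_sq u xs rho : mR -> mR).
Proof.
apply: measurable_funM; first exact: measurable_cst.
apply: (measurable_int3_ball (f := fun t x => sqnorm (u t x))).
  exact: measurable_sqnorm_velocity.
by move=> t x; exact: sqnorm_ge0.
Qed.

(** The energy bound identifies the difference [S_swirl] on the lifespan with the integral of a
    nonnegative density, to which Tonelli's measurability applies. *)
Lemma measurable_S_swirl rho : 0 < rho ->
  measurable_fun (lifespan T) (S_swirl u xs rho : mR -> mR).
Proof.
move=> rho0; have [[K uK] _] := eu.
have m : measurable_fun (lifespan T) (fun t : mR =>
    rho^-1 * int3 (eball xs rho) (fun x => u_theta u t x ^+ 2) : mR).
  apply: measurable_funM; first exact: measurable_cst.
  apply: (measurable_int3_ball (f := fun t x => u_theta u t x ^+ 2)).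
    exact: measurable_sqr_u_theta.
  by move=> t x; exact: sqr_ge0.
by apply: eq_measurable_fun m => t /set_mem Tt; rewrite (S_swirlE su au zs rho Tt (uK t Tt)).
Qed.

Lemma measurable_expR_S_swirl (D : set mR) rho (k : R) : 0 < rho ->
  measurable D -> D `<=` lifespan T ->
  measurable_fun D (fun t => (expR (S_swirl u xs rho t / k) - 1)%:E).
Proof.
move=> rho0 mD DT; apply/measurable_EFinP.
apply: measurable_funB; last exact: measurable_cst.
apply: (measurableT_comp (@measurable_expR R)).
apply: measurable_funM; last exact: measurable_cst.
by apply: measurable_funS (measurable_S_swirl rho0) => //; exact: measurable_lifespan.
Qed.

Lemma integral_expR_S_swirl_le (rho : R) (I : set mR) : 0 < rho ->
  measurable I -> I `<=` lifespan T ->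
  (\int[leb1]_(t in I) (expR (S_swirl u xs rho t / (2 * pi * Gs ^+ 2)) - 1)%:E
    <= (E_kin u * rho / (2 * pi * nu * Gs ^+ 2))%:E)%E.
Proof.
move=> rho0 mI IT; have [[K uK] Eu] := eu.
have pi0 := pi_gt0 R.
have fE (p : R) : 0 < p -> rho / (2 * p * Gs ^+ 2) * (E_kin u / nu)
    = E_kin u * rho / (2 * p * nu * Gs ^+ 2).
  by move=> p0; field; rewrite !gt_eqF.
have k0 : 0 < 2 * pi * Gs ^+ 2 by rewrite !mulr_gt0// exprn_gt0.
pose g (t : mR) := eint3 (fun x => (grad_sq u t x)%:E).
have g0 t : (0 <= g t)%E.
  by apply: integral_ge0 => p _; rewrite lee_fin; apply: sumr_ge0 => j _; exact: sqnorm_ge0.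
have mT := measurable_lifespan T.
have mg : measurable_fun (lifespan T) g.
  apply: (@measurable_time_integral _ (lifespan T) setT
    (fun q => (grad_sq u q.1 (of_triple q.2))%:E)) => //.
    by apply/measurable_EFinP; exact: measurable_grad_sq.
  by move=> q _; rewrite lee_fin; apply: sumr_ge0 => j _; exact: sqnorm_ge0.
have mgI : measurable_fun I g by exact: measurable_funS mg.
apply: (@le_trans _ _ (\int[leb1]_(t in I) ((rho / (2 * pi * Gs ^+ 2))%:E * g t))%E).
  apply: ge0_le_integral => //.
  - move=> t It; rewrite lee_fin subr_ge0 -[leLHS]expR0 ler_expR divr_ge0 ?(ltW k0)//.
    exact: (S_swirl_ge0 su au zs rho0 (IT t It) (uK t (IT t It))).
  - exact: (measurable_expR_S_swirl (2 * pi * Gs ^+ 2) rho0 mI IT).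
  - exact: measurable_funeM.
  - move=> t /IT Tt; apply: (expR_S_swirl_le su au zs rho0 Tt (uK t Tt) Gs0).
    exact: Linfty3_ae (circ Tt).
have c0 : 0 < rho / (2 * pi * Gs ^+ 2) by rewrite divr_gt0.
rewrite ge0_integralZl//; last by rewrite lee_fin ltW.
have gE : (\int[leb1]_(t in I) g t <= (E_kin u / nu)%:E)%E.
  apply: (@le_trans _ _ (\int[leb1]_(t in lifespan T) g t)%E).
    by apply: ge0_subset_integral => // t _; exact: g0.
  by rewrite EFinM muleC lee_pdivlMl.
apply: (@le_trans _ _ ((rho / (2 * pi * Gs ^+ 2))%:E * (E_kin u / nu)%:E)%E).
  by rewrite lee_pmul2l// lte_fin.
rewrite -EFinM lee_fin le_eqVlt; apply/orP; left; apply/eqP.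
exact: fE.
Qed.

Lemma E_kin_ge0 : 0 <= E_kin u.
Proof.
rewrite mulr_ge0// ?invr_ge0//; apply: Rintegral_ge0 => p _; exact: sqnorm_ge0.
Qed.

End swirl_in_time.

(* the tangent of [expR] at [ln (1 + c)] is integrated *)
Lemma average_le_ln (R : realType) (I : set (measurableTypeR R)) (S : R -> R) (l k c : R) :
  measurable I -> leb1 I = l%:E -> 0 < l -> 0 < k -> 0 <= c ->
  measurable_fun I (S : measurableTypeR R -> measurableTypeR R) ->
  (forall t, I t -> 0 <= S t) ->
  (\int[leb1]_(t in I) (expR (S t / k) - 1)%:E <= (l * c)%:E)%E ->
  l^-1 * \int[leb1]_(t in I) S t <= k * ln (1 + c).
Proof.
move=> mI Il l0 k0 c0 mS S0 eS; set m := 1 + c.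
have m0 : 0 < m by rewrite ltr_wpDr.
have mN0 : m != 0 by rewrite gt_eqF.
(* The constant term when [S t] is bounded by an affine function of [expR (S t / k) - 1] with slope
   [k / m], equality holding at [S t = k * ln m]. Since [c = m - 1], [d + k / m * c] is exactly
   [k * ln m]. *)
pose d := k * (ln m - 1 + m^-1).
have d0 : 0 <= d.
  rewrite mulr_ge0 ?(ltW k0)//.
  by have := expR_ge1Dx (- ln m); rewrite expRN lnK ?posrE//; lra.
have e0 t : I t -> 0 <= expR (S t / k) - 1.
  by move=> It; rewrite subr_ge0 -[leLHS]expR0 ler_expR divr_ge0 ?(ltW k0)// S0.
have Sle t : S t <= d + k / m * (expR (S t / k) - 1).
  have := expR_ge1Dx (S t / k - ln m).
  rewrite expRD expRN lnK ?posrE// -(ler_pM2l k0) => h.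
  have -> : d + k / m * (expR (S t / k) - 1) = k * ln m - k + k * (expR (S t / k) * m^-1).
    by rewrite /d; ring.
  apply: le_trans (lerD (lexx _) h).
  have -> : k * ln m - k + k * (1 + (S t / k - ln m)) = S t by field; rewrite gt_eqF.
  exact: lexx.
have me : measurable_fun I (fun t => (expR (S t / k) - 1)%:E).
  apply/measurable_EFinP; apply: measurable_funB; last exact: measurable_cst.
  apply: (measurableT_comp (@measurable_expR R)).
  by apply: measurable_funM => //; exact: measurable_cst.
have km0 : 0 <= k / m by rewrite divr_ge0 ?ltW.
have mke : measurable_fun I (fun t => (k / m)%:E * (expR (S t / k) - 1)%:E)%E.
  exact: measurable_funeM.
have h : (\int[leb1]_(t in I) (S t)%:E <= (l * (k * ln m))%:E)%E.
  apply: (@le_trans _ _ (\int[leb1]_(t in I) (d%:E + (k / m)%:E * (expR (S t / k) - 1)%:E))%E).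
    apply: ge0_le_integral => //.
    - exact/measurable_EFinP.
    - by apply: emeasurable_funD => //; exact: measurable_cst.
    - by move=> t It; rewrite -EFinM -EFinD lee_fin.
  rewrite ge0_integralD//; last by move=> t It; rewrite mule_ge0 ?lee_fin// e0.
  rewrite integral_cst// Il ge0_integralZl//.
  apply: (@le_trans _ _ (d%:E * l%:E + (k / m)%:E * (l * c)%:E)%E).
    by rewrite leeD2l// lee_wpmul2l.
  rewrite -!EFinM -EFinD lee_fin le_eqVlt; apply/orP; left; apply/eqP.
  have cE : c = m - 1 by rewrite /m addrC addKr.
  by rewrite cE /d; field.
rewrite ler_pdivrMl// -lee_fin; apply: le_trans h.
have : (0 <= \int[leb1]_(t in I) (S t)%:E)%E.
  by apply: integral_ge0 => t It; rewrite lee_fin S0.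
by rewrite /Rintegral; case: (integral _ _ _) => [r| |] //=; rewrite leey.
Qed.

Lemma par_intervalE (R : realType) (tau t rho : R) :
  par_interval tau t rho = `[t - tau * rho ^+ 2, t]%classic.
Proof. by apply/seteqP; split => s; rewrite /par_interval /= in_itv. Qed.

Lemma leb1_par_interval (R : realType) (tau t rho : R) : 0 < tau -> 0 < rho ->
  leb1 (par_interval tau t rho) = (tau * rho ^+ 2)%:E.
Proof.
move=> tau0 rho0; have h : 0 < tau * rho ^+ 2 by rewrite mulr_gt0// exprn_gt0.
rewrite par_intervalE /leb1 [LHS]lebesgue_measure_itv /= lte_fin ifT; last by lra.
by rewrite -EFinB; congr EFin; ring.
Qed.

Section averages.
Context {R : realType}.
Context (nu : R) (T : \bar R) (u : R -> 'rV[R]_3 -> 'rV[R]_3) (Gs zs : R).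
Hypothesis nu0 : 0 < nu.
Hypothesis su : smooth_on (spacetime T) (fun q => u q.1 q.2).
Hypothesis au : axisymmetric T u.
Hypothesis eu : finite_energy nu T u.
Hypothesis Gs0 : 0 < Gs.
Hypothesis circ : forall t, lifespan T t -> (Linfty3 (circulation u t) <= Gs%:E)%E.
Let mR := measurableTypeR R.
Local Notation xs := (axis_point zs).

Context (rho tau t : R).
Hypotheses (rho0 : 0 < rho) (tau0 : 0 < tau).
Hypothesis It : par_interval tau t rho `<=` lifespan T.
Let I : set mR := par_interval tau t rho.

Let mI : measurable I.
Proof. by rewrite /I par_intervalE; exact: measurable_itv. Qed.

Lemma par_average_S_swirl_le : par_average tau t rho (S_swirl u xs rho)
  <= 2 * pi * Gs ^+ 2 * ln (1 + E_kin u / (2 * pi * nu * Gs ^+ 2 * tau * rho)).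
Proof.
have [[K uK] _] := eu; have pi0 := pi_gt0 R.
have l0 : 0 < tau * rho ^+ 2 by rewrite mulr_gt0// exprn_gt0.
have cE (p : R) : 0 < p -> E_kin u * rho / (2 * p * nu * Gs ^+ 2)
    = tau * rho ^+ 2 * (E_kin u / (2 * p * nu * Gs ^+ 2 * tau * rho)).
  by move=> p0; field; rewrite !gt_eqF.
apply: (@average_le_ln _ I) => //.
- exact: leb1_par_interval.
- by rewrite !mulr_gt0// exprn_gt0.
- by rewrite divr_ge0 ?E_kin_ge0 ?mulr_ge0 ?exprn_ge0// ltW.
- apply: measurable_funS (measurable_S_swirl zs su au eu rho0) => //.
  exact: measurable_lifespan.
- by move=> s /It Ts; exact: (S_swirl_ge0 su au zs rho0 Ts (uK s Ts)).
- rewrite -cE//; exact: (integral_expR_S_swirl_le zs nu0 su au eu Gs0 circ).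
Qed.

Lemma bounded_integrable_par (f : R -> R) (C : R) :
  measurable_fun (lifespan T) (f : mR -> mR) ->
  (forall s, lifespan T s -> 0 <= f s <= C) -> leb1.-integrable I (EFin \o f).
Proof.
move=> mf f0; apply/integrableP; split.
  apply/measurable_EFinP; apply: measurable_funS mf => //.
  exact: measurable_lifespan.
apply: (@le_lt_trans _ _ (\int[leb1]_(s in I) C%:E)%E).
  apply: ge0_le_integral => //.
  - apply: measurableT_comp => //; apply/measurable_EFinP.
    by apply: measurable_funS mf => //; exact: measurable_lifespan.
  - by move=> s /It /f0 /andP[? ?]; rewrite /= lee_fin ger0_norm.
by rewrite integral_cst// [X in (_ * X)%E]leb1_par_interval// -EFinM ltry.
Qed.

Lemma par_average_M_mer : par_average tau t rho (M_mer u xs rho)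
  = par_average tau t rho (A_sq u xs rho) - par_average tau t rho (S_swirl u xs rho).
Proof.
have [[K uK] _] := eu.
have A0 s : lifespan T s -> 0 <= A_sq u xs rho s <= rho^-1 * K.
  by move=> Ts; exact: (A_sq_bound su zs rho0 Ts (uK s Ts)).
have iA : leb1.-integrable I (EFin \o A_sq u xs rho).
  by apply: bounded_integrable_par A0; exact: (measurable_A_sq zs su).
have iS : leb1.-integrable I (EFin \o S_swirl u xs rho).
  apply: (@bounded_integrable_par _ (rho^-1 * K)).
    exact: (measurable_S_swirl zs su au eu rho0).
  move=> s Ts; rewrite (S_swirl_ge0 su au zs rho0 Ts (uK s Ts)) /=.
  by have /andP[_] := A0 s Ts; apply: le_trans; exact: S_swirl_le_A_sq.
rewrite /par_average -mulrBr -RintegralB//; congr (_ * _).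
by apply: eq_Rintegral => s _; rewrite /S_swirl opprB addrC subrK.
Qed.

End averages.

(** * The meridional fraction at small radii *)

Lemma ln_div_ln_cvg0 (R : realType) (rho0 e : R) : 0 < rho0 -> 0 < e ->
  ln ((rho + e) / rho0) / ln (rho0 / rho) @[rho --> 0^'+] --> (0 : R).
Proof.
(* Because [e > 0], the numerator has the finite limit [ln (e / rho0)], while the reciprocal of the
   denominator tends to [0]. *)
move=> r0 e0; rewrite -[X in _ --> X](mulr0 (ln (e / rho0))).
apply: cvgM.
  apply: cvg_at_right_filter.
  have c : (rho + e) / rho0 @[rho --> (0 : R)] --> e / rho0.
    rewrite -{2}(add0r e).
    by apply: cvgM; [apply: cvgD; [exact: cvg_id|exact: cvg_cst]|exact: cvg_cst].
  by apply: (@cvg_comp _ _ _ _ (@ln R) _ _ _ c); apply: continuous_ln; rewrite divr_gt0.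
apply/cvgrPdist_lt => d d0.
near=> rho.
have rho_gt0 : 0 < rho by [].
(* Below this threshold the denominator exceeds [d^-1 + 1], so its inverse is less than [d]. *)
have : rho < rho0 / expR (d^-1 + 1).
  by near: rho; apply: nbhs_right_lt; rewrite divr_gt0// expR_gt0.
rewrite ltr_pdivlMr ?expR_gt0// mulrC -ltr_pdivlMr// => h.
have : d^-1 + 1 < ln (rho0 / rho).
  by rewrite -ltr_expR lnK ?posrE ?divr_gt0.
set L := ln _ => dL.
have d1 : 0 < d^-1 by rewrite invr_gt0.
have L0 : 0 < L by lra.
rewrite sub0r normrN gtr0_norm ?invr_gt0// invf_plt ?posrE//; lra.
Unshelve. all: by end_near. Qed.

Theorem theorem10p2 (R : realType) (nu : R) (T : \bar R)
    (u : R -> 'rV[R]_3 -> 'rV[R]_3) (Gs zs : R) :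
  0 < nu -> (0 < T)%E ->
  smooth_NS_solution nu T u ->
  axisymmetric T u ->
  finite_energy nu T u ->
  0 < Gs ->
  (forall t, lifespan T t -> (Linfty3 (circulation u t) <= Gs%:E)%E) ->
  let xs := axis_point zs in
  [/\ (forall (rho : R) (I : interval R), 0 < rho -> [set` I] `<=` lifespan T ->
         (\int[leb1]_(t in [set` I])
            (expR (S_swirl u xs rho t / (2 * pi * Gs ^+ 2)) - 1)%:E
          <= (E_kin u * rho / (2 * pi * nu * Gs ^+ 2))%:E)%E),
      (forall rho tau t : R, 0 < rho -> 0 < tau ->
         par_interval tau t rho `<=` lifespan T ->
         par_average tau t rho (S_swirl u xs rho)
         <= 2 * pi * Gs ^+ 2 *
            ln (1 + E_kin u / (2 * pi * nu * Gs ^+ 2 * tau * rho))) &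
      (forall (rho0 C tau : R) (t_ : R -> R), 0 < rho0 -> 0 < C -> 0 < tau ->
         (\forall rho \near 0^'+,
            par_interval tau (t_ rho) rho `<=` lifespan T) ->
         (\forall rho \near 0^'+,
            C * Gs ^+ 2 * ln (rho0 / rho)
            <= par_average tau (t_ rho) rho (A_sq u xs rho)) ->
         (exists o : R -> R, o rho @[rho --> 0^'+] --> 0 /\
            \forall rho \near 0^'+,
              1 - 2 * pi / C - o rho
              <= par_average tau (t_ rho) rho (M_mer u xs rho)
                 / par_average tau (t_ rho) rho (A_sq u xs rho)) /\
         (8 * pi / 3 < C ->
            \forall rho \near 0^'+,
              1 / 4 < par_average tau (t_ rho) rho (M_mer u xs rho)
                      / par_average tau (t_ rho) rho (A_sq u xs rho)))].
Proof.
move=> nu0 T0 [su _] au eu Gs0 circ xs.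
have pi0 := pi_gt0 R.
split.
- move=> rho I rho0 IT.
  exact: (integral_expR_S_swirl_le zs nu0 su au eu Gs0 circ rho0 (measurable_itv I) IT).
- move=> rho tau t rho0 tau0 It.
  exact: (par_average_S_swirl_le zs nu0 su au eu Gs0 circ rho0 tau0 It).
move=> r0 C tau t_ r00 C0 tau0 nI nA.
pose c := E_kin u / (2 * pi * nu * Gs ^+ 2 * tau).
have c0 : 0 <= c.
  by rewrite divr_ge0 ?E_kin_ge0 ?mulr_ge0 ?exprn_ge0 ?(ltW pi0) ?(ltW nu0) ?(ltW tau0) ?(ltW Gs0).
(* From [ln ((rho + c + 1) / rho) = ln (r0 / rho) + ln ((rho + c + 1) / r0)]: the first term yields
   [2 * pi / C], the second the error. Enlarging [c] to [c + 1] keeps the limit of the second term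
   finite even when the kinetic energy is zero. *)
pose o rho := 2 * pi / C * (ln ((rho + (c + 1)) / r0) / ln (r0 / rho)).
have o0 : o rho @[rho --> 0^'+] --> 0.
  rewrite -[X in _ --> X](mulr0 (2 * pi / C)); apply: cvgM; first exact: cvg_cst.
  by apply: ln_div_ln_cvg0 => //; rewrite ltr_wpDl.
have ratio : \forall rho \near 0^'+, 1 - 2 * pi / C - o rho
    <= par_average tau (t_ rho) rho (M_mer u xs rho)
       / par_average tau (t_ rho) rho (A_sq u xs rho).
  near=> rho.
  have rho0 : 0 < rho by [].
  have It : par_interval tau (t_ rho) rho `<=` lifespan T by near: rho.
  have rho_r0 : rho < r0 by near: rho; exact: nbhs_right_lt.
  have L0 : 0 < ln (r0 / rho) by rewrite ln_gt0// ltr_pdivlMr// mul1r.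
  have hA : C * Gs ^+ 2 * ln (r0 / rho)
      <= par_average tau (t_ rho) rho (A_sq u xs rho) by near: rho.
  have G20 : 0 < Gs ^+ 2 by rewrite exprn_gt0.
  have hS := par_average_S_swirl_le zs nu0 su au eu Gs0 circ rho0 tau0 It.
  rewrite (par_average_M_mer zs su au eu rho0 tau0 It) -/xs.
  move: hA hS; set A := par_average _ _ _ (A_sq _ _ _).
  set S := par_average _ _ _ (S_swirl _ _ _) => hA hS.
  have A0 : 0 < A by apply: lt_le_trans hA; rewrite !mulr_gt0.
  have cE : E_kin u / (2 * pi * nu * Gs ^+ 2 * tau * rho) = c / rho.
    by rewrite /c invfM mulrA.
  have hS' : S <= 2 * pi * Gs ^+ 2 * ln ((rho + (c + 1)) / rho).
    apply: le_trans hS _; rewrite cE ler_pM2l ?mulr_gt0//.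
    have c1 : 1 + c / rho <= (rho + (c + 1)) / rho.
      by rewrite [leRHS]mulrDl divff ?gt_eqF// lerD2l ler_pM2r ?invr_gt0// lerDl.
    have c2 : 0 < 1 + c / rho by rewrite ltr_pwDl// divr_ge0// ltW.
    by rewrite ler_ln ?posrE// (lt_le_trans c2).
  have lnE : ln ((rho + (c + 1)) / rho) = ln (r0 / rho) + ln ((rho + (c + 1)) / r0).
    have rc0 : 0 < rho + (c + 1) by rewrite addr_gt0// ltr_wpDl.
    by rewrite !ln_div ?posrE//; ring.
  have oE : 2 * pi / C + o rho
      = 2 * pi * Gs ^+ 2 * ln ((rho + (c + 1)) / rho) / (C * Gs ^+ 2 * ln (r0 / rho)).
    rewrite lnE /o; move: (ln _) (ln _) L0 => x y; move: (2 * pi) => p x0.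
    by field; rewrite !gt_eqF.
  rewrite mulrBl divff ?gt_eqF// -addrA lerD2l -opprD lerN2 oE.
  (* [S] is replaced by its bound before [A]: lowering the denominator requires a nonnegative
     numerator, which holds as the logarithm's argument is at least [1]. *)
  apply: (@le_trans _ _ (2 * pi * Gs ^+ 2 * ln ((rho + (c + 1)) / rho) / A)).
    by rewrite ler_pM2r ?invr_gt0.
  rewrite ler_wpM2l//; last by rewrite lef_pV2 ?posrE// !mulr_gt0.
  rewrite !mulr_ge0 ?exprn_ge0 ?(ltW pi0) ?(ltW Gs0)// ln_ge0//.
  by rewrite ler_pdivlMr// mul1r lerDl; rewrite addr_ge0.
split; first by exists o.
move=> C83.
(* This margin is [1 - 2 * pi / C] minus the target [1 / 4]; it is positive exactly when
   [C > 8 * pi / 3], and the error eventually falls below it. *)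
have d0 : 0 < 3 / 4 - 2 * pi / C.
  by rewrite subr_gt0 ltr_pdivrMr//; lra.
move/cvgrPdist_lt : o0 => /(_ _ d0) od.
near=> rho.
have r1 : 1 - 2 * pi / C - o rho
    <= par_average tau (t_ rho) rho (M_mer u xs rho)
       / par_average tau (t_ rho) rho (A_sq u xs rho) by near: rho.
apply: lt_le_trans r1.
have : `|0 - o rho| < 3 / 4 - 2 * pi / C by near: rho.
rewrite sub0r normrN => /ltr_normlW; lra.
Unshelve. all: by end_near. Qed.
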